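(* Let $H$ be a Hopf algebra with antipode $S$ over a field $K$. Assume there exists an $ad$-invariant integral $\lambda\in H^{*}$. Then: (i) The forgetful functor ${}_{A}\mathfrak{M}_{A}^{H}\to{}_{A}\mathfrak{M}_{A}$ is separable for every algebra $A$ in $\mathfrak{M}^{H}$. (ii) The forgetful functor ${}_{A}^{H}\mathfrak{M}_{A}\to{}_{A}\mathfrak{M}_{A}$ is separable for every algebra $A$ in ${}^{H}\mathfrak{M}$. (iii) The forgetful functor ${}_{A}^{H}\mathfrak{M}_{A}^{H}\to{}_{A}\mathfrak{M}_{A}$ is separable for every algebra $A$ in ${}^{H}\mathfrak{M}^{H}$.
   Context: Notation: $\Delta(h)=h_1\otimes h_2$ (Sweedler), $\varepsilon$ the counit of $H$. $ad$-invariant integral: $\lambda\in H^{*}$ such that (a) $h_1\lambda(h_2)=1_H\lambda(h)$ for all $h\in H$; (b) $\lambda(h_1xS(h_2))=\varepsilon(h)\lambda(x)$ for all $h,x\in H$; (c) $\lambda(1_H)=1_K$. $\mathfrak{M}^H$, ${}^H\mathfrak{M}$, ${}^H\mathfrak{M}^H$ are the monoidal categories of right, left, two-sided $H$-comodules, with $\otimes_K$ carrying codiagonal coaction(s) and unit $K$. For an algebra $A$ in one of these categories $\mathcal{M}$, the category of $A$-bimodules in $\mathcal{M}$ ($A$-bimodules that are objects of $\mathcal{M}$ with actions being morphisms in $\mathcal{M}$) is denoted ${}_{A}\mathfrak{M}_{A}^{H}$, ${}_{A}^{H}\mathfrak{M}_{A}$, ${}_{A}^{H}\mathfrak{M}_{A}^{H}$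 respectively; ${}_A\mathfrak{M}_A$ is the category of ordinary $A$-bimodules. Separable functor: a functor $U:\mathfrak{B}\to\mathfrak{A}$ such that the natural transformation $\mathrm{Hom}_{\mathfrak B}(\bullet,\bullet)\to \mathrm{Hom}_{\mathfrak A}(U(\bullet),U(\bullet))$, $f\mapsto U(f)$, of functors $\mathfrak{B}^{op}\times\mathfrak{B}\to\mathfrak{Sets}$ has a left inverse natural transformation. *)

(* Defs.v *)
From HB Require Import structures.
From mathcomp Require Import all_boot all_algebra.
From mathcomp Require Import boolp freeg.

Set Implicit Arguments.
Unset Strict Implicit.
Unset Printing Implicit Defensive.

Import GRing.Theory.
Local Open Scope ring_scope.
Local Open Scope quotient_scope.

(* The subspace of the free vector space on V * W spanned by the bilinearity
   relations. *)
Inductive tensor_rel (K : fieldType) (V W : lmodType K) :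
    {freeg (V * W)%type / K} -> Prop :=
| tensor_rel0 : tensor_rel 0
| tensor_rel_lin a x y :
    tensor_rel x -> tensor_rel y -> tensor_rel (a *: x + y)
| tensor_rel_linl a v v' w :
    tensor_rel (<< (a *: v + v', w) >> - (a *: << (v, w) >> + << (v', w) >>))
| tensor_rel_linr a v w w' :
    tensor_rel (<< (v, a *: w + w') >> - (a *: << (v, w) >> + << (v, w') >>)).

Section TensorDef.
Variables (K : fieldType) (V W : lmodType K).
Local Notation F := {freeg (V * W)%type / K}.
Implicit Types x y z : F.

Definition tensor_eqv x y : bool := `[< tensor_rel (x - y) >].

Lemma tensor_relZ a x : tensor_rel x -> tensor_rel (a *: x).
Proof. by move=> h; rewrite -[_ *: _]addr0; apply: tensor_rel_lin h (tensor_rel0 _ _). Qed.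

Lemma tensor_relD x y : tensor_rel x -> tensor_rel y -> tensor_rel (x + y).
Proof. by move=> hx hy; rewrite -[x]scale1r; apply: tensor_rel_lin. Qed.

Lemma tensor_eqv_refl : reflexive tensor_eqv.
Proof. by move=> x; apply/asboolP; rewrite subrr; apply: tensor_rel0. Qed.

Lemma tensor_eqv_sym : symmetric tensor_eqv.
Proof.
have h x y : tensor_eqv x y -> tensor_eqv y x.
  move/asboolP=> /(tensor_relZ (-1)); rewrite scaleN1r opprB => ?.
  exact/asboolP.
by move=> x y; apply/idP/idP; apply: h.
Qed.

Lemma tensor_eqv_trans : transitive tensor_eqv.
Proof.
move=> y x z /asboolP hxy /asboolP hyz; apply/asboolP.
by have := tensor_relD hxy hyz; rewrite addrA subrK.
Qed.

Canonical tensor_eqv_equiv :=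
  EquivRel tensor_eqv tensor_eqv_refl tensor_eqv_sym tensor_eqv_trans.

Definition tensor := {eq_quot tensor_eqv}.

HB.instance Definition _ := Choice.on tensor.
HB.instance Definition _ := Quotient.on tensor.

Definition tensor_of (x : F) : tensor := \pi_tensor x.

Lemma tensor_ofP x y : tensor_of x = tensor_of y <-> tensor_rel (x - y).
Proof.
by split=> [/eqquotP/asboolP|h]; last apply/eqquotP/asboolP.
Qed.

Lemma tensor_ofK (t : tensor) : tensor_of (repr t) = t.
Proof. exact: reprK. Qed.

Lemma repr_tensor_of x : tensor_rel (repr (tensor_of x) - x).
Proof. by apply/tensor_ofP; rewrite tensor_ofK. Qed.

Definition tensor_add (s t : tensor) := tensor_of (repr s + repr t).
Definition tensor_opp (t : tensor) := tensor_of (- repr t).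
Definition tensor_scale a (t : tensor) := tensor_of (a *: repr t).

Lemma tensor_ofD x y : tensor_add (tensor_of x) (tensor_of y) = tensor_of (x + y).
Proof.
by apply/tensor_ofP; rewrite opprD addrACA; apply: tensor_relD;
  apply: repr_tensor_of.
Qed.

Lemma tensor_ofZ a x : tensor_scale a (tensor_of x) = tensor_of (a *: x).
Proof.
by apply/tensor_ofP; rewrite -scalerBr; apply/tensor_relZ/repr_tensor_of.
Qed.

Lemma tensor_ofN x : tensor_opp (tensor_of x) = tensor_of (- x).
Proof.
rewrite -scaleN1r -tensor_ofZ /tensor_scale /tensor_opp.
by rewrite scaleN1r.
Qed.

Lemma tensor_addA : associative tensor_add.
Proof.
move=> s t u; rewrite -[s]tensor_ofK -[t]tensor_ofK -[u]tensor_ofK.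
by rewrite !tensor_ofD addrA.
Qed.

Lemma tensor_addC : commutative tensor_add.
Proof. by move=> s t; rewrite /tensor_add addrC. Qed.

Lemma tensor_add0 : left_id (tensor_of 0) tensor_add.
Proof. by move=> s; rewrite -[s]tensor_ofK tensor_ofD add0r. Qed.

Lemma tensor_addN : left_inverse (tensor_of 0) tensor_opp tensor_add.
Proof. by move=> s; rewrite -[s]tensor_ofK tensor_ofN tensor_ofD addNr. Qed.

HB.instance Definition _ := GRing.isZmodule.Build tensor
  tensor_addA tensor_addC tensor_add0 tensor_addN.

Lemma tensor_scaleA a b t :
  tensor_scale a (tensor_scale b t) = tensor_scale (a * b) t.
Proof. by rewrite -[t]tensor_ofK !tensor_ofZ scalerA. Qed.

Lemma tensor_scale1 : left_id 1 tensor_scale.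
Proof. by move=> t; rewrite -[t]tensor_ofK tensor_ofZ scale1r. Qed.

Lemma tensor_scaleDr : right_distributive tensor_scale +%R.
Proof.
move=> a s t; rewrite -[s]tensor_ofK -[t]tensor_ofK.
by rewrite [_ + _]tensor_ofD !tensor_ofZ [RHS]tensor_ofD scalerDr.
Qed.

Lemma tensor_scaleDl t : {morph tensor_scale^~ t : a b / a + b}.
Proof.
move=> a b; rewrite -[t]tensor_ofK.
by rewrite !tensor_ofZ [RHS]tensor_ofD scalerDl.
Qed.

HB.instance Definition _ := GRing.Zmodule_isLmodule.Build K tensor
  tensor_scaleA tensor_scale1 tensor_scaleDr tensor_scaleDl.

Lemma tensor_of_is_linear : linear tensor_of.
Proof. by move=> a x y; rewrite -tensor_ofD -tensor_ofZ. Qed.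

HB.instance Definition _ :=
  GRing.isLinear.Build K F tensor *:%R tensor_of tensor_of_is_linear.

End TensorDef.

Arguments tensor {K} V%_type W%_type.

Definition tpure (K : fieldType) (V W : lmodType K) (v : V) (w : W) :
  tensor V W := tensor_of << (v, w) >>.

Notation "V ⊗ W" := (tensor V W)
  (at level 40, left associativity) : type_scope.
Notation "v ⊗ w" := (tpure v w)
  (at level 40, left associativity) : ring_scope.

Definition bilin (K : fieldType) (V W U : lmodType K) (f : V -> W -> U) :=
  (forall w, linear (f^~ w)) /\ (forall v, linear (f v)).

(* For f bilinear, the linear map V ⊗ W -> U with v ⊗ w |-> f v w, i.e.
   [tlift (fun v w => e) t] is e in Sweedler notation v ⊗ w for t. (It depends
   on the choice of representatives when f is not bilinear.) *)
Definition tlift (K : fieldType) (V W U : lmodType K) (f : V -> W -> U)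
  (t : V ⊗ W) : U := fglift (fun vw => f vw.1 vw.2) (repr t).

Section TensorTheory.
Variable K : fieldType.
Implicit Types V W U : lmodType K.

Lemma tpure_bilin V W : bilin (@tpure K V W).
Proof.
split=> [w|v] a x y; rewrite /tpure -linearP; apply/tensor_ofP.
  exact: tensor_rel_linl.
exact: tensor_rel_linr.
Qed.

Lemma fglift_linear (T : choiceType) U (f : T -> U) :
  linear (fglift f : {freeg T / K} -> U).
Proof.
have fB := lift_is_additive f.
have f0 : fglift f 0 = 0 by rewrite -[X in fglift f X](subrr 0) fB subrr.
have fD x y : fglift f (x + y) = fglift f x + fglift f y.
  by rewrite -[y in LHS]opprK fB -[- y]add0r fB f0 sub0r opprK.
have fS (I : eqType) (r : seq I) F :
    fglift f (\sum_(i <- r) F i) = \sum_(i <- r) fglift f (F i).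
  by elim/big_rec2: _ => // i x y _ <-.
move=> a x y; rewrite fD; congr (_ + _).
rewrite -[in LHS](freeg_sumE x) -[in RHS](freeg_sumE x) scaler_sumr !fS scaler_sumr.
apply: eq_bigr => t _; rewrite liftU scalerA.
have -> : a *: << coeff t x *g t >> = << a * coeff t x *g t >> :> {freeg T / K}.
  by apply/eqP/freeg_eqP => u; rewrite coeffZ !coeffU mulrA.
by rewrite liftU.
Qed.

Lemma tlift_of V W U (f : V -> W -> U) x : bilin f ->
  tlift f (tensor_of x) = fglift (fun vw => f vw.1 vw.2) x.
Proof.
move=> [fl fr]; set g := fun vw => f vw.1 vw.2.
have gl := fglift_linear g.
pose G : {linear _ -> _} := HB.pack (fglift g) (GRing.isLinear.Build _ _ _ _ _ gl).
suff h z : tensor_rel z -> G z = 0.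
  have := h _ (repr_tensor_of x); rewrite linearB => /eqP.
  by rewrite subr_eq0 => /eqP.
elim=> [|a u v _ hu _ hv|a v v' w|a v w w']; first exact: linear0.
- by rewrite linearP hu hv scaler0 addr0.
- by rewrite linearB linearP /= !liftU /g /= !scale1r (fl w) subrr.
- by rewrite linearB linearP /= !liftU /g /= !scale1r (fr v) subrr.
Qed.

Lemma tlift_pure V W U (f : V -> W -> U) v w : bilin f ->
  tlift f (v ⊗ w) = f v w.
Proof. by move=> fb; rewrite tlift_of // liftU scale1r. Qed.

Lemma tlift_linear V W U (f : V -> W -> U) : bilin f -> linear (tlift f).
Proof.
move=> fb a s t; rewrite -[s]tensor_ofK -[t]tensor_ofK -linearP !tlift_of //.
exact: fglift_linear.
Qed.

Lemma tpureDl V W (v v' : V) (w : W) : (v + v') ⊗ w = v ⊗ w + v' ⊗ w.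
Proof. by have [h _] := tpure_bilin V W; have := h w 1 v v'; rewrite !scale1r. Qed.

Lemma tpureDr V W (v : V) (w w' : W) : v ⊗ (w + w') = v ⊗ w + v ⊗ w'.
Proof. by have [_ h] := tpure_bilin V W; have := h v 1 w w'; rewrite !scale1r. Qed.

Lemma tpure0l V W (w : W) : (0 : V) ⊗ w = 0.
Proof. by apply: (addrI (0 ⊗ w)); rewrite -tpureDl !addr0. Qed.

Lemma tpure0r V W (v : V) : v ⊗ (0 : W) = 0.
Proof. by apply: (addrI (v ⊗ 0)); rewrite -tpureDr !addr0. Qed.

Lemma tpureZl V W a (v : V) (w : W) : (a *: v) ⊗ w = a *: (v ⊗ w).
Proof.
by have [h _] := tpure_bilin V W; have := h w a v 0; rewrite tpure0l !addr0.
Qed.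

Lemma tpureZr V W a (v : V) (w : W) : v ⊗ (a *: w) = a *: (v ⊗ w).
Proof.
by have [_ h] := tpure_bilin V W; have := h v a w 0; rewrite tpure0r !addr0.
Qed.

Lemma tensor_ind V W (P : V ⊗ W -> Prop) :
  (forall v w, P (v ⊗ w)) -> (forall s t, P s -> P t -> P (s + t)) ->
  forall t, P t.
Proof.
move=> Pp PD t; rewrite -[t]tensor_ofK -(freeg_sumE (repr t)) raddf_sum.
apply: (big_ind P) => // [|[v w] _]; first by rewrite -(tpure0l V 0).
set c := coeff _ _.
have -> : << c *g (v, w) >> = c *: << (v, w) >> :> {freeg (V * W)%type / K}.
  by apply/eqP/freeg_eqP => u; rewrite coeffZ !coeffU mul1r.
by rewrite /= linearZ /= -[tensor_of _]/(v ⊗ w) -tpureZl.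
Qed.

Lemma linear_D U V (f : U -> V) : linear f -> {morph f : x y / x + y}.
Proof. by move=> fl x y; have := fl 1 x y; rewrite !scale1r. Qed.

Lemma tensor_ext V W U (f g : V ⊗ W -> U) : linear f -> linear g ->
  (forall v w, f (v ⊗ w) = g (v ⊗ w)) -> f =1 g.
Proof.
move=> /linear_D fl /linear_D gl h t; elim/tensor_ind: t => // s t hs ht.
by rewrite fl gl hs ht.
Qed.

Lemma tensor_extL V W U (f g : {linear (V ⊗ W)%type -> U}) :
  (forall v w, f (v ⊗ w) = g (v ⊗ w)) -> f =1 g.
Proof. by apply: tensor_ext; apply: linearP. Qed.

Lemma tensor_extL2 V W V' W' U
    (f g : {linear ((V ⊗ W) ⊗ (V' ⊗ W'))%type -> U}) :
  (forall v w v' w',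
    f ((v ⊗ w) ⊗ (v' ⊗ w')) = g ((v ⊗ w) ⊗ (v' ⊗ w'))) -> f =1 g.
Proof.
move=> h; apply: tensor_extL => s t.
elim/tensor_ind: s => [v w|s s' hs hs']; last by rewrite tpureDl !linearD hs hs'.
by elim/tensor_ind: t => [v' w'|t t' ht ht']; last rewrite tpureDr !linearD ht ht'.
Qed.

Lemma tlift_param V W U (X : lmodType K) (f : X -> V -> W -> U) t :
  (forall x, bilin (f x)) -> (forall v w, linear (fun x => f x v w)) ->
  linear (fun x => tlift (f x) t).
Proof.
move=> fb fx a x y.
have fl z := linear_D (tlift_linear (fb z)).
elim/tensor_ind: t => [v w|s t hs ht]; first by rewrite !tlift_pure // fx.
by rewrite !fl hs ht scalerDr addrACA.
Qed.

Lemma linear_ext U V (f g : {linear U -> V}) : f =1 g -> f = g.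
Proof.
case: f => f [[f1] [f2]]; case: g => g [[g1] [g2]] /= /funext fg.
case: _ / fg in g1 g2 *.
by rewrite (Prop_irrelevance f1 g1) (Prop_irrelevance f2 g2).
Qed.

End TensorTheory.

Section TensorMaps.
Variable K : fieldType.
Implicit Types U V W : lmodType K.

Definition tmap V W V' W' (f : V -> V') (g : W -> W') (t : V ⊗ W) : V' ⊗ W' :=
  tlift (fun v w => f v ⊗ g w) t.

Definition tassoc U V W (t : (U ⊗ V) ⊗ W) : U ⊗ (V ⊗ W) :=
  tlift (fun uv w => tlift (fun u v => u ⊗ (v ⊗ w)) uv) t.

Definition tinter V W V' W' (t : (V ⊗ W) ⊗ (V' ⊗ W')) : (V ⊗ V') ⊗ (W ⊗ W') :=
  tlift (fun vw vw' =>
    tlift (fun v w => tlift (fun v' w' => (v ⊗ v') ⊗ (w ⊗ w')) vw') vw) t.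

Definition tpureE := (tpureDl, tpureDr, tpureZl, tpureZr).

Section Linearity.
Variables (V W V' W' : lmodType K).

Lemma tmap_bilin (f : {linear V -> V'}) (g : {linear W -> W'}) :
  bilin (fun v w => f v ⊗ g w).
Proof. by split=> [w|v] a x y; rewrite linearP !tpureE. Qed.

Lemma tmap_pure (f : {linear V -> V'}) (g : {linear W -> W'}) v w :
  tmap f g (v ⊗ w) = f v ⊗ g w.
Proof. exact: tlift_pure (tmap_bilin f g). Qed.

HB.instance Definition _ (f : {linear V -> V'}) (g : {linear W -> W'}) :=
  GRing.isLinear.Build K (V ⊗ W)%type (V' ⊗ W')%type *:%R (tmap f g)
    (tlift_linear (tmap_bilin f g)).

Lemma tassoc_bilin0 U (w : W) :
  bilin (fun (u : U) (v : V) => u ⊗ (v ⊗ w)).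
Proof. by split=> [v|u] a x y; rewrite !tpureE. Qed.

Lemma tassoc_bilin U :
  bilin (fun uv (w : W) => tlift (fun (u : U) (v : V) => u ⊗ (v ⊗ w)) uv).
Proof.
split=> [w|uv]; first exact: tlift_linear (tassoc_bilin0 _ w).
apply: tlift_param => [w|u v a x y]; first exact: tassoc_bilin0.
by rewrite !tpureE.
Qed.

Lemma tassoc_pure U (u : U) (v : V) (w : W) :
  tassoc ((u ⊗ v) ⊗ w) = u ⊗ (v ⊗ w).
Proof.
rewrite /tassoc (tlift_pure _ _ (tassoc_bilin U)).
exact: tlift_pure (tassoc_bilin0 _ w).
Qed.

HB.instance Definition _ U :=
  GRing.isLinear.Build K ((U ⊗ V) ⊗ W)%type (U ⊗ (V ⊗ W))%type *:%R (@tassoc U V W)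
    (tlift_linear (tassoc_bilin U)).

Lemma tinter_bilin0 (v : V) (w : W) :
  bilin (fun (v' : V') (w' : W') => (v ⊗ v') ⊗ (w ⊗ w')).
Proof. by split=> [w'|v'] a x y; rewrite !tpureE. Qed.

Lemma tinter_bilin1 (t : V' ⊗ W') :
  bilin (fun v w => tlift (fun v' w' => (v ⊗ v') ⊗ (w ⊗ w')) t : (V ⊗ V') ⊗ (W ⊗ W')).
Proof.
split=> [w|v]; apply: tlift_param => *; first exact: tinter_bilin0.
- by move=> a x y; rewrite !tpureE.
- exact: tinter_bilin0.
- by move=> a x y; rewrite !tpureE.
Qed.

Lemma tinter_bilin : bilin (fun vw vw' =>
  tlift (fun v w => tlift (fun v' w' => (v ⊗ v') ⊗ (w ⊗ w')) vw') vw
  : (V ⊗ V') ⊗ (W ⊗ W')).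
Proof.
split=> [t|s]; first exact: tlift_linear (tinter_bilin1 t).
apply: tlift_param => [t|v w]; first exact: tinter_bilin1.
exact: tlift_linear (tinter_bilin0 v w).
Qed.

Lemma tinter_pure v w v' w' :
  tinter ((v ⊗ w) ⊗ (v' ⊗ w')) = (v ⊗ v') ⊗ (w ⊗ w') :> (V ⊗ V') ⊗ (W ⊗ W').
Proof.
rewrite /tinter (tlift_pure _ _ tinter_bilin).
rewrite (tlift_pure _ _ (tinter_bilin1 _)).
exact: tlift_pure (tinter_bilin0 v w).
Qed.

HB.instance Definition _ :=
  GRing.isLinear.Build K ((V ⊗ W) ⊗ (V' ⊗ W'))%type ((V ⊗ V') ⊗ (W ⊗ W'))%type *:%R
    (@tinter V W V' W') (tlift_linear tinter_bilin).

End Linearity.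

Definition tpure_at V W (w : W) (v : V) : (V ⊗ W)%type := v ⊗ w.

Lemma tpure_at_linear V W (w : W) : linear (@tpure_at V W w).
Proof. by move=> a x y; rewrite /tpure_at !tpureE. Qed.

HB.instance Definition _ (V W : lmodType K) (w : W) :=
  GRing.isLinear.Build K V (V ⊗ W)%type *:%R (@tpure_at V W w)
    (@tpure_at_linear V W w).

Definition tmul (A : algType K) (t : A ⊗ A) : A := tlift *%R t.

Lemma mul_bilin (A : algType K) : bilin ( *%R : A -> A -> A).
Proof.
by split=> [w|v] a x y; rewrite ?mulrDl ?mulrDr -?scalerAl -?scalerAr.
Qed.

Lemma tmul_pure (A : algType K) (x y : A) : tmul (x ⊗ y) = x * y.
Proof. exact: tlift_pure (mul_bilin A). Qed.

HB.instance Definition _ (A : algType K) :=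
  GRing.isLinear.Build K (A ⊗ A)%type A *:%R (@tmul A) (tlift_linear (mul_bilin A)).

Definition scale_unit V (v : V) (k : K^o) : V := k *: v.

Lemma scale_unit_linear V (v : V) : linear (scale_unit v).
Proof. by move=> a x y; rewrite /scale_unit scalerDl scalerA. Qed.

HB.instance Definition _ V (v : V) :=
  GRing.isLinear.Build K K^o V *:%R (scale_unit v) (scale_unit_linear v).

End TensorMaps.

HB.mixin Record Algebra_isHopf (K : fieldType) H of GRing.Algebra K H := {
  comul : {linear H -> (H ⊗ H)%type};
  counit : {scalar H};
  antipode : {linear H -> H};
  comulA : forall h,
    tassoc (tmap comul idfun (comul h)) = tmap idfun comul (comul h);
  counitl : forall h, tlift (fun h1 h2 => counit h1 *: h2) (comul h) = h;
  counitr : forall h, tlift (fun h1 h2 => counit h2 *: h1) (comul h) = h;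
  comul1 : comul 1 = 1 ⊗ 1;
  comulM : forall h k,
    comul (h * k) =
    tmap (@tmul K H) (@tmul K H) (tinter (comul h ⊗ comul k));
  counit1 : counit 1 = 1;
  counitM : {morph counit : h k / h * k};
  antipodel : forall h,
    tlift (fun h1 h2 => antipode h1 * h2) (comul h) = counit h *: 1;
  antipoder : forall h,
    tlift (fun h1 h2 => h1 * antipode h2) (comul h) = counit h *: 1
}.

#[short(type="hopfAlgType")]
HB.structure Definition HopfAlgebra (K : fieldType) :=
  {H of GRing.Algebra K H & Algebra_isHopf K H}.

Record ad_invariant_integral (K : fieldType) (H : hopfAlgType K)
    (lambda : {scalar H}) : Prop := {
  integral_colinear : forall h : H,
    tlift (fun h1 h2 : H => lambda h2 *: h1) (comul h) = lambda h *: 1;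
  integral_ad : forall h x : H,
    tlift (fun h1 h2 : H => lambda (h1 * x * antipode h2) : K^o) (comul h)
    = counit h * lambda x;
  integral1 : lambda 1 = 1
}.

Record category := Category {
  cobj :> Type;
  chom : cobj -> cobj -> Type;
  cid : forall X, chom X X;
  ccomp : forall X Y Z, chom Y Z -> chom X Y -> chom X Z;
  ccomp1l : forall X Y (f : chom X Y), ccomp (cid Y) f = f;
  ccomp1r : forall X Y (f : chom X Y), ccomp f (cid X) = f;
  ccompA : forall X Y Z T (h : chom Z T) (g : chom Y Z) (f : chom X Y),
    ccomp h (ccomp g f) = ccomp (ccomp h g) f
}.

Record functor (B A : category) := Functor {
  fobj :> B -> A;
  fmap : forall X Y : B, chom X Y -> chom (fobj X) (fobj Y);
  fmap1 : forall X : B, fmap (cid X) = cid (fobj X);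
  fmap_comp : forall (X Y Z : B) (g : chom Y Z) (f : chom X Y),
    fmap (ccomp g f) = ccomp (fmap g) (fmap f)
}.

Definition separable (B A : category) (U : functor B A) : Prop :=
  exists P : forall X Y : B, chom (U X) (U Y) -> chom X Y,
    (forall (X X' Y Y' : B) (f : chom X' X) (h : chom Y Y')
            (g : chom (U X) (U Y)),
       P X' Y' (ccomp (fmap U h) (ccomp g (fmap U f)))
       = ccomp h (ccomp (P X Y g) f))
    /\ (forall (X Y : B) (f : chom X Y), P X Y (fmap U f) = f).

(* A monoidal category of vector spaces with extra structure (mstr): the
   morphisms are the linear maps that respect it (mmor), the tensor product and
   the unit are V ⊗ W and K with the structures mtens and munit, and the
   constraints are those of vector spaces. Only the part of this data that is
   needed to speak of algebras and bimodules is recorded. *)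
Record moncat (K : fieldType) := MonCat {
  mstr : lmodType K -> Type;
  mmor : forall V W : lmodType K,
    mstr V -> mstr W -> {linear V -> W} -> Prop;
  mtens : forall V W : lmodType K, mstr V -> mstr W -> mstr (V ⊗ W)%type;
  munit : mstr K^o;
  mmor_id : forall (V : lmodType K) (s : mstr V), mmor s s idfun;
  mmor_comp : forall (V W X : lmodType K)
    (s : mstr V) (t : mstr W) (u : mstr X)
    (g : {linear W -> X}) (f : {linear V -> W}),
    mmor t u g -> mmor s t f -> mmor s u (g \o f)
}.

Section Comodules.
Variables (K : fieldType) (H : hopfAlgType K).
Implicit Types V W : lmodType K.

Record rcoaction V := RCoaction {
  rcoact :> {linear V -> (V ⊗ H)%type};
  rcoactA : forall v,
    tassoc (tmap rcoact idfun (rcoact v)) = tmap idfun comul (rcoact v);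
  rcoact1 : forall v, tlift (fun v0 (v1 : H) => counit v1 *: v0) (rcoact v) = v
}.

Record lcoaction V := LCoaction {
  lcoact :> {linear V -> (H ⊗ V)%type};
  lcoactA : forall v,
    tassoc (tmap comul idfun (lcoact v)) = tmap idfun lcoact (lcoact v);
  lcoact1 : forall v, tlift (fun (v1 : H) v0 => counit v1 *: v0) (lcoact v) = v
}.

Record bicoaction V := BiCoaction {
  bicoactl : lcoaction V;
  bicoactr : rcoaction V;
  bicoactA : forall v,
    tassoc (tmap bicoactl idfun (bicoactr v)) = tmap idfun bicoactr (bicoactl v)
}.

Definition rcolinear V W (rV : rcoaction V) (rW : rcoaction W)
    (f : {linear V -> W}) : Prop :=
  forall v, rW (f v) = tmap f idfun (rV v).

Definition lcolinear V W (lV : lcoaction V) (lW : lcoaction W)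
    (f : {linear V -> W}) : Prop :=
  forall v, lW (f v) = tmap idfun f (lV v).

Definition bicolinear V W (bV : bicoaction V) (bW : bicoaction W)
    (f : {linear V -> W}) : Prop :=
  lcolinear (bicoactl bV) (bicoactl bW) f /\
  rcolinear (bicoactr bV) (bicoactr bW) f.

Definition rcodiag_map V W (rV : {linear V -> (V ⊗ H)%type})
    (rW : {linear W -> (W ⊗ H)%type}) :
    {linear (V ⊗ W)%type -> ((V ⊗ W) ⊗ H)%type} :=
  tmap idfun (@tmul K H) \o @tinter K V H W H \o tmap rV rW.

Definition lcodiag_map V W (lV : {linear V -> (H ⊗ V)%type})
    (lW : {linear W -> (H ⊗ W)%type}) :
    {linear (V ⊗ W)%type -> (H ⊗ (V ⊗ W))%type} :=
  tmap (@tmul K H) idfun \o @tinter K H V H W \o tmap lV lW.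

Definition runit_map (k : K^o) : (K^o ⊗ H)%type := k ⊗ 1.
Definition lunit_map (k : K^o) : (H ⊗ K^o)%type := 1 ⊗ k.

Lemma runit_map_linear : linear runit_map.
Proof. by move=> a x y; rewrite /runit_map !tpureE. Qed.

Lemma lunit_map_linear : linear lunit_map.
Proof. by move=> a x y; rewrite /lunit_map !tpureE. Qed.

HB.instance Definition _ :=
  GRing.isLinear.Build K K^o (K^o ⊗ H)%type *:%R runit_map runit_map_linear.
HB.instance Definition _ :=
  GRing.isLinear.Build K K^o (H ⊗ K^o)%type *:%R lunit_map lunit_map_linear.

Definition rcounit_map V (t : V ⊗ H) : V :=
  tlift (fun v0 (v1 : H) => counit v1 *: v0) t.
Definition lcounit_map V (t : H ⊗ V) : V :=
  tlift (fun (v1 : H) v0 => counit v1 *: v0) t.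

Lemma rcounit_bilin V : bilin (fun (v0 : V) (v1 : H) => counit v1 *: v0).
Proof.
split=> w a x y; first by rewrite scalerDr !scalerA mulrC.
by rewrite linearP /= scalerDl scalerA.
Qed.

Lemma lcounit_bilin V : bilin (fun (v1 : H) (v0 : V) => counit v1 *: v0).
Proof.
split=> w a x y; first by rewrite linearP /= scalerDl scalerA.
by rewrite scalerDr !scalerA mulrC.
Qed.

HB.instance Definition _ (V : lmodType K) := GRing.isLinear.Build K (V ⊗ H)%type V *:%R
  (@rcounit_map V) (tlift_linear (rcounit_bilin V)).
HB.instance Definition _ (V : lmodType K) := GRing.isLinear.Build K (H ⊗ V)%type V *:%R
  (@lcounit_map V) (tlift_linear (lcounit_bilin V)).

Lemma rcounit_pure V (v : V) (h : H) : rcounit_map (v ⊗ h) = counit h *: v.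
Proof. exact: tlift_pure (rcounit_bilin V). Qed.

Lemma lcounit_pure V (v : V) (h : H) : lcounit_map (h ⊗ v) = counit h *: v.
Proof. exact: tlift_pure (lcounit_bilin V). Qed.

Definition simp_pure :=
  (tmap_pure, tassoc_pure, tinter_pure, tmul_pure, rcounit_pure, lcounit_pure).

Section Codiagonal.
Variables V W : lmodType K.

Section Right.
Variables (rV : rcoaction V) (rW : rcoaction W).
Local Notation R := (rcodiag_map rV rW).

Lemma rcodiag_coactA t : tassoc (tmap R idfun (R t)) = tmap idfun comul (R t).
Proof.
pose q : {linear ((V ⊗ H) ⊗ (W ⊗ H))%type -> ((V ⊗ W) ⊗ H)%type} :=
  tmap idfun (@tmul K H) \o @tinter K V H W H.
pose phi : {linear ((V ⊗ (H ⊗ H)) ⊗ (W ⊗ (H ⊗ H)))%type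
            -> ((V ⊗ W) ⊗ (H ⊗ H))%type} :=
  tmap idfun (tmap (@tmul K H) (@tmul K H) \o @tinter K H H H H)
  \o @tinter K V (H ⊗ H)%type W (H ⊗ H)%type.
pose aV : {linear (V ⊗ H)%type -> (V ⊗ (H ⊗ H))%type} :=
  @tassoc K V H H \o tmap rV idfun.
pose aW : {linear (W ⊗ H)%type -> (W ⊗ (H ⊗ H))%type} :=
  @tassoc K W H H \o tmap rW idfun.
have h1 : @tassoc K _ H H \o (tmap R idfun \o q) =1 phi \o tmap aV aW.
  apply: tensor_extL2 => v h w k.
  rewrite /q /phi /aV /aW /= !simp_pure /= !simp_pure.
  have h0 : @tassoc K _ H H \o (tpure_at (h * k) \o q)
      =1 phi \o tmap (@tassoc K V H H \o tpure_at h)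
                     (@tassoc K W H H \o tpure_at k).
    apply: tensor_extL2 => v' h' w' k'.
    rewrite /q /phi /= !simp_pure /= /tpure_at !simp_pure /=.
    by rewrite !simp_pure /= ?simp_pure.
  by have := h0 (rV v ⊗ rW w); rewrite /phi /q /= tmap_pure.
have h2 : tmap idfun comul \o q =1 phi \o tmap (tmap idfun comul) (tmap idfun comul).
  apply: tensor_extL2 => v h w k.
  by rewrite /q /phi /= !simp_pure /= !simp_pure /= comulM.
apply: (tensor_extL (f := @tassoc K _ H H \o (tmap R idfun \o R))
  (g := tmap idfun comul \o R)) t => v w.
have eR : R (v ⊗ w) = q (rV v ⊗ rW w) by rewrite /= tmap_pure.
apply: (etrans (congr1 (fun z => tassoc (tmap R idfun z)) eR)).
apply: (etrans (h1 _)); apply/esym/(etrans (congr1 (tmap idfun comul) eR)).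
by apply: (etrans (h2 _)); rewrite /= !tmap_pure /= !rcoactA.
Qed.

Lemma rcodiag_coact1 t : rcounit_map (R t) = t.
Proof.
pose q : {linear ((V ⊗ H) ⊗ (W ⊗ H))%type -> ((V ⊗ W) ⊗ H)%type} :=
  tmap idfun (@tmul K H) \o @tinter K V H W H.
have h : @rcounit_map _ \o q =1 tmap (@rcounit_map V) (@rcounit_map W).
  apply: tensor_extL2 => v h w k.
  rewrite /q /= !simp_pure /= !simp_pure /= counitM.
  by rewrite !tpureE scalerA.
apply: (tensor_extL (f := @rcounit_map _ \o R) (g := idfun)) t => v w.
have e : R (v ⊗ w) = q (rV v ⊗ rW w) by rewrite /= tmap_pure.
apply: (etrans (congr1 (@rcounit_map _) e)); apply: (etrans (h _)).
by rewrite tmap_pure /= /rcounit_map !rcoact1.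
Qed.

Definition rcodiag : rcoaction (V ⊗ W)%type :=
  RCoaction rcodiag_coactA rcodiag_coact1.
End Right.

Section Left.
Variables (lV : lcoaction V) (lW : lcoaction W).
Local Notation L := (lcodiag_map lV lW).

Lemma lcodiag_coactA t : tassoc (tmap comul idfun (L t)) = tmap idfun L (L t).
Proof.
pose q : {linear ((H ⊗ V) ⊗ (H ⊗ W))%type -> (H ⊗ (V ⊗ W))%type} :=
  tmap (@tmul K H) idfun \o @tinter K H V H W.
pose phi : {linear ((H ⊗ (H ⊗ V)) ⊗ (H ⊗ (H ⊗ W)))%type
            -> (H ⊗ (H ⊗ (V ⊗ W)))%type} :=
  tmap (@tmul K H) q \o @tinter K H (H ⊗ V)%type H (H ⊗ W)%type.
pose cV : {linear (H ⊗ V)%type -> (H ⊗ (H ⊗ V))%type} :=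
  @tassoc K H H V \o tmap comul idfun.
pose cW : {linear (H ⊗ W)%type -> (H ⊗ (H ⊗ W))%type} :=
  @tassoc K H H W \o tmap comul idfun.
have h1 : @tassoc K H H _ \o (tmap comul idfun \o q) =1 phi \o tmap cV cW.
  apply: tensor_extL2 => h v k w.
  rewrite /q /phi /cV /cW /= !simp_pure /= !simp_pure /= comulM.
  have h0 : @tassoc K H H _ \o (tpure_at (v ⊗ w)
        \o (tmap (@tmul K H) (@tmul K H) \o @tinter K H H H H))
      =1 phi \o tmap (@tassoc K H H V \o tpure_at v)
                     (@tassoc K H H W \o tpure_at w).
    apply: tensor_extL2 => h1 h2 k1 k2.
    rewrite /phi /q /= !simp_pure /= /tpure_at !simp_pure /=.
    by rewrite !simp_pure /= ?simp_pure.
  by have := h0 (comul h ⊗ comul k); rewrite /phi /q /= tmap_pure.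
have h2 : tmap idfun L \o q =1 phi \o tmap (tmap idfun lV) (tmap idfun lW).
  apply: tensor_extL2 => h v k w.
  by rewrite /q /phi /= !simp_pure /= !simp_pure /= ?simp_pure.
apply: (tensor_extL (f := @tassoc K H H _ \o (tmap comul idfun \o L))
  (g := tmap idfun L \o L)) t => v w.
have eL : L (v ⊗ w) = q (lV v ⊗ lW w) by rewrite /= tmap_pure.
apply: (etrans (congr1 (fun z => tassoc (tmap comul idfun z)) eL)).
apply: (etrans (h1 _)); apply/esym/(etrans (congr1 (tmap idfun L) eL)).
by apply: (etrans (h2 _)); rewrite /= !tmap_pure /= !lcoactA.
Qed.

Lemma lcodiag_coact1 t : lcounit_map (L t) = t.
Proof.
pose q : {linear ((H ⊗ V) ⊗ (H ⊗ W))%type -> (H ⊗ (V ⊗ W))%type} :=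
  tmap (@tmul K H) idfun \o @tinter K H V H W.
have h : @lcounit_map _ \o q =1 tmap (@lcounit_map V) (@lcounit_map W).
  apply: tensor_extL2 => h v k w.
  rewrite /q /= !simp_pure /= !simp_pure /= counitM.
  by rewrite !tpureE scalerA.
apply: (tensor_extL (f := @lcounit_map _ \o L) (g := idfun)) t => v w.
have e : L (v ⊗ w) = q (lV v ⊗ lW w) by rewrite /= tmap_pure.
apply: (etrans (congr1 (@lcounit_map _) e)); apply: (etrans (h _)).
by rewrite tmap_pure /= /lcounit_map !lcoact1.
Qed.

Definition lcodiag : lcoaction (V ⊗ W)%type :=
  LCoaction lcodiag_coactA lcodiag_coact1.
End Left.

Section TwoSided.
Variables (bV : bicoaction V) (bW : bicoaction W).
Local Notation L := (lcodiag (bicoactl bV) (bicoactl bW)).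
Local Notation R := (rcodiag (bicoactr bV) (bicoactr bW)).

Lemma bicodiag_coactA t : tassoc (tmap L idfun (R t)) = tmap idfun R (L t).
Proof.
pose q : {linear ((V ⊗ H) ⊗ (W ⊗ H))%type -> ((V ⊗ W) ⊗ H)%type} :=
  tmap idfun (@tmul K H) \o @tinter K V H W H.
pose p : {linear ((H ⊗ V) ⊗ (H ⊗ W))%type -> (H ⊗ (V ⊗ W))%type} :=
  tmap (@tmul K H) idfun \o @tinter K H V H W.
pose phi : {linear ((H ⊗ (V ⊗ H)) ⊗ (H ⊗ (W ⊗ H)))%type
            -> (H ⊗ ((V ⊗ W) ⊗ H))%type} :=
  tmap (@tmul K H) q \o @tinter K H (V ⊗ H)%type H (W ⊗ H)%type.
pose aV : {linear (V ⊗ H)%type -> (H ⊗ (V ⊗ H))%type} :=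
  @tassoc K H V H \o tmap (bicoactl bV) idfun.
pose aW : {linear (W ⊗ H)%type -> (H ⊗ (W ⊗ H))%type} :=
  @tassoc K H W H \o tmap (bicoactl bW) idfun.
have h1 : @tassoc K H _ H \o (tmap L idfun \o q) =1 phi \o tmap aV aW.
  apply: tensor_extL2 => v h w k.
  rewrite /q /phi /aV /aW /= !simp_pure /= !simp_pure.
  have h0 : @tassoc K H _ H \o (tpure_at (h * k) \o p)
      =1 phi \o tmap (@tassoc K H V H \o tpure_at h)
                     (@tassoc K H W H \o tpure_at k).
    apply: tensor_extL2 => h' v' k' w'.
    rewrite /p /q /phi /= !simp_pure /= /tpure_at !simp_pure /=.
    by rewrite !simp_pure /= ?simp_pure.
  by have := h0 (bicoactl bV v ⊗ bicoactl bW w); rewrite /phi /q /p /= tmap_pure.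
have h2 : tmap idfun R \o p
    =1 phi \o tmap (tmap idfun (bicoactr bV)) (tmap idfun (bicoactr bW)).
  apply: tensor_extL2 => h v k w.
  by rewrite /p /q /phi /= !simp_pure /= !simp_pure /= ?simp_pure.
apply: (tensor_extL (f := @tassoc K H _ H \o (tmap L idfun \o R))
  (g := tmap idfun R \o L)) t => v w.
have eR : R (v ⊗ w) = q (bicoactr bV v ⊗ bicoactr bW w) by rewrite /= tmap_pure.
have eL : L (v ⊗ w) = p (bicoactl bV v ⊗ bicoactl bW w) by rewrite /= tmap_pure.
apply: (etrans (congr1 (fun z => tassoc (tmap L idfun z)) eR)).
apply: (etrans (h1 _)); apply/esym/(etrans (congr1 (tmap idfun R) eL)).
by apply: (etrans (h2 _)); rewrite /= !tmap_pure /= !bicoactA.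
Qed.

Definition bicodiag : bicoaction (V ⊗ W)%type := BiCoaction bicodiag_coactA.
End TwoSided.

End Codiagonal.

Lemma runit_coactA k :
  tassoc (tmap runit_map idfun (runit_map k)) = tmap idfun comul (runit_map k).
Proof.
by rewrite -[runit_map k]/(k ⊗ 1) !tmap_pure /= comul1 /runit_map tassoc_pure.
Qed.

Lemma runit_coact1 k : rcounit_map (runit_map k) = k.
Proof. by rewrite rcounit_pure counit1 scale1r. Qed.

Lemma lunit_coactA k :
  tassoc (tmap comul idfun (lunit_map k)) = tmap idfun lunit_map (lunit_map k).
Proof.
by rewrite -[lunit_map k]/(1 ⊗ k) !tmap_pure /= comul1 /lunit_map tassoc_pure.
Qed.

Lemma lunit_coact1 k : lcounit_map (lunit_map k) = k.
Proof. by rewrite lcounit_pure counit1 scale1r. Qed.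

Definition runit : rcoaction K^o := RCoaction runit_coactA runit_coact1.
Definition lunit : lcoaction K^o := LCoaction lunit_coactA lunit_coact1.

Lemma biunit_coactA k :
  tassoc (tmap lunit idfun (runit k)) = tmap idfun runit (lunit k).
Proof.
rewrite /= -[runit_map k]/(k ⊗ 1) -[lunit_map k]/(1 ⊗ k) !tmap_pure /=.
by rewrite /lunit_map /runit_map tassoc_pure.
Qed.

Definition biunit : bicoaction K^o := BiCoaction biunit_coactA.

Lemma tmap_id V W (t : V ⊗ W) : tmap idfun idfun t = t.
Proof.
by move: t; apply: (tensor_extL (f := tmap idfun idfun) (g := idfun)) => v w;
  rewrite /= tmap_pure.
Qed.

Lemma tmap_comp V W V' W' V'' W'' (f' : {linear V' -> V''})
    (g' : {linear W' -> W''}) (f : {linear V -> V'}) (g : {linear W -> W'}) t :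
  tmap f' g' (tmap f g t) = tmap (f' \o f) (g' \o g) t.
Proof.
by move: t; apply: (tensor_extL (f := tmap f' g' \o tmap f g)) => v w;
  rewrite /= !tmap_pure.
Qed.

Lemma rcolinear_id V (s : rcoaction V) : rcolinear s s idfun.
Proof. by move=> v; rewrite tmap_id. Qed.

Lemma lcolinear_id V (s : lcoaction V) : lcolinear s s idfun.
Proof. by move=> v; rewrite tmap_id. Qed.

Lemma rcolinear_comp V W (X : lmodType K)
    (s : rcoaction V) (t : rcoaction W) (u : rcoaction X)
    (g : {linear W -> X}) (f : {linear V -> W}) :
  rcolinear t u g -> rcolinear s t f -> rcolinear s u (g \o f).
Proof. by move=> hg hf v; rewrite /= hg hf tmap_comp. Qed.

Lemma lcolinear_comp V W (X : lmodType K)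
    (s : lcoaction V) (t : lcoaction W) (u : lcoaction X)
    (g : {linear W -> X}) (f : {linear V -> W}) :
  lcolinear t u g -> lcolinear s t f -> lcolinear s u (g \o f).
Proof. by move=> hg hf v; rewrite /= hg hf tmap_comp. Qed.

Lemma bicolinear_id V (s : bicoaction V) : bicolinear s s idfun.
Proof. by split; [apply: lcolinear_id|apply: rcolinear_id]. Qed.

Lemma bicolinear_comp V W (X : lmodType K)
    (s : bicoaction V) (t : bicoaction W) (u : bicoaction X)
    (g : {linear W -> X}) (f : {linear V -> W}) :
  bicolinear t u g -> bicolinear s t f -> bicolinear s u (g \o f).
Proof.
by move=> [lg rg] [lf rf]; split;
  [apply: lcolinear_comp lg lf|apply: rcolinear_comp rg rf].
Qed.

Definition rcomod : moncat K :=
  MonCat rcodiag runit rcolinear_id rcolinear_comp.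
Definition lcomod : moncat K :=
  MonCat lcodiag lunit lcolinear_id lcolinear_comp.
Definition bicomod : moncat K :=
  MonCat bicodiag biunit bicolinear_id bicolinear_comp.

End Comodules.

(* Unlike algType, this allows the zero algebra. *)
Record algebra (K : fieldType) := MkAlgebra {
  alg_space :> lmodType K;
  amul : {linear (alg_space ⊗ alg_space)%type -> alg_space};
  aone : alg_space;
  amulA : forall x y z, amul (x ⊗ amul (y ⊗ z)) = amul (amul (x ⊗ y) ⊗ z);
  amul1l : forall x, amul (aone ⊗ x) = x;
  amul1r : forall x, amul (x ⊗ aone) = x
}.

Record bimodule (K : fieldType) (A : algebra K) := MkBimodule {
  bim_space :> lmodType K;
  lact : {linear (A ⊗ bim_space)%type -> bim_space};
  ract : {linear (bim_space ⊗ A)%type -> bim_space};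
  lactA : forall (a b : A) m, lact (a ⊗ lact (b ⊗ m)) = lact (amul A (a ⊗ b) ⊗ m);
  lact1 : forall m, lact (aone A ⊗ m) = m;
  ractA : forall (a b : A) m, ract (ract (m ⊗ a) ⊗ b) = ract (m ⊗ amul A (a ⊗ b));
  ract1 : forall m, ract (m ⊗ aone A) = m;
  lractA : forall (a b : A) m,
    ract (lact (a ⊗ m) ⊗ b) = lact (a ⊗ ract (m ⊗ b))
}.

Record bimodule_hom (K : fieldType) (A : algebra K) (M N : bimodule A) :=
  BimoduleHom {
  bim_map :> {linear M -> N};
  bim_map_lact : forall (a : A) (m : M),
    bim_map (lact M (a ⊗ m)) = lact N (a ⊗ bim_map m);
  bim_map_ract : forall (a : A) (m : M),
    bim_map (ract M (m ⊗ a)) = ract N (bim_map m ⊗ a)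
}.

Record algebra_in (K : fieldType) (C : moncat K) := AlgebraIn {
  in_alg :> algebra K;
  alg_str : mstr C in_alg;
  amul_mor : mmor (mtens alg_str alg_str) alg_str (amul in_alg);
  aone_mor : mmor (munit C) alg_str (scale_unit (aone in_alg))
}.

Record bimodule_in (K : fieldType) (C : moncat K) (A : algebra_in C) :=
  BimoduleIn {
  in_bim :> bimodule A;
  bim_str : mstr C in_bim;
  lact_mor : mmor (mtens (alg_str A) bim_str) bim_str (lact in_bim);
  ract_mor : mmor (mtens bim_str (alg_str A)) bim_str (ract in_bim)
}.

Record bimodule_in_hom (K : fieldType) (C : moncat K) (A : algebra_in C)
    (M N : bimodule_in A) := BimoduleInHom {
  in_bim_hom :> bimodule_hom M N;
  bim_map_mor : mmor (bim_str M) (bim_str N) (bim_map in_bim_hom)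
}.

Section Bimodules.
Variable K : fieldType.

Section Ordinary.
Variable A : algebra K.
Implicit Types M N P Q : bimodule A.

Lemma bimodule_hom_ext M N (f g : bimodule_hom M N) : f =1 g -> f = g.
Proof.
case: f => f f1 f2; case: g => g g1 g2 /= /linear_ext fg.
case: _ / fg in g1 g2 *.
by rewrite (Prop_irrelevance f1 g1) (Prop_irrelevance f2 g2).
Qed.

Definition bimodule_id M : bimodule_hom M M :=
  BimoduleHom (bim_map := idfun) (fun _ _ => erefl) (fun _ _ => erefl).

Lemma bimodule_comp_lact M N P (g : bimodule_hom N P) (f : bimodule_hom M N)
    (a : A) (m : M) :
  (g \o f) (lact M (a ⊗ m)) = lact P (a ⊗ (g \o f) m).
Proof. by rewrite /= !bim_map_lact. Qed.

Lemma bimodule_comp_ract M N P (g : bimodule_hom N P) (f : bimodule_hom M N)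
    (a : A) (m : M) :
  (g \o f) (ract M (m ⊗ a)) = ract P ((g \o f) m ⊗ a).
Proof. by rewrite /= !bim_map_ract. Qed.

Definition bimodule_comp M N P (g : bimodule_hom N P) (f : bimodule_hom M N) :
    bimodule_hom M P :=
  BimoduleHom (bim_map := g \o f)
    (bimodule_comp_lact g f) (bimodule_comp_ract g f).

Lemma bimodule_comp1l M N (f : bimodule_hom M N) :
  bimodule_comp (bimodule_id N) f = f.
Proof. exact: bimodule_hom_ext. Qed.

Lemma bimodule_comp1r M N (f : bimodule_hom M N) :
  bimodule_comp f (bimodule_id M) = f.
Proof. exact: bimodule_hom_ext. Qed.

Lemma bimodule_compA M N P Q (h : bimodule_hom P Q) (g : bimodule_hom N P)
    (f : bimodule_hom M N) :
  bimodule_comp h (bimodule_comp g f) = bimodule_comp (bimodule_comp h g) f.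
Proof. exact: bimodule_hom_ext. Qed.

Definition bimod : category :=
  Category bimodule_comp1l bimodule_comp1r bimodule_compA.

End Ordinary.

Section InMonoidal.
Variables (C : moncat K) (A : algebra_in C).
Implicit Types M N P Q : bimodule_in A.

Lemma bimodule_in_hom_ext M N (f g : bimodule_in_hom M N) :
  in_bim_hom f = in_bim_hom g -> f = g.
Proof.
case: f => f f1; case: g => g g1 /= fg; case: _ / fg in g1 *.
by rewrite (Prop_irrelevance f1 g1).
Qed.

Definition bimodule_in_id M : bimodule_in_hom M M :=
  BimoduleInHom (in_bim_hom := bimodule_id M) (mmor_id (bim_str M)).

Definition bimodule_in_comp M N P (g : bimodule_in_hom N P)
    (f : bimodule_in_hom M N) : bimodule_in_hom M P :=
  BimoduleInHom (in_bim_hom := bimodule_comp g f)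
    (mmor_comp (bim_map_mor g) (bim_map_mor f)).

Lemma bimodule_in_comp1l M N (f : bimodule_in_hom M N) :
  bimodule_in_comp (bimodule_in_id N) f = f.
Proof. exact/bimodule_in_hom_ext/bimodule_comp1l. Qed.

Lemma bimodule_in_comp1r M N (f : bimodule_in_hom M N) :
  bimodule_in_comp f (bimodule_in_id M) = f.
Proof. exact/bimodule_in_hom_ext/bimodule_comp1r. Qed.

Lemma bimodule_in_compA M N P Q (h : bimodule_in_hom P Q)
    (g : bimodule_in_hom N P) (f : bimodule_in_hom M N) :
  bimodule_in_comp h (bimodule_in_comp g f)
  = bimodule_in_comp (bimodule_in_comp h g) f.
Proof. exact/bimodule_in_hom_ext/bimodule_compA. Qed.

Definition bimod_in : category :=
  Category bimodule_in_comp1l bimodule_in_comp1r bimodule_in_compA.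

Definition forget : functor bimod_in (bimod A) :=
  Functor (B := bimod_in) (A := bimod A)
    (fobj := @in_bim K C A) (fmap := fun M N => @in_bim_hom K C A M N)
    (fun _ => erefl) (fun _ _ _ _ _ => erefl).

End InMonoidal.
End Bimodules.

(* Main.v *)
(* Write θ(h ⊗ k) = λ(h S(k)). Given a linear map f : V -> W between right
   comodules, put
     (avg f)(v) = f(v0)_0 θ(f(v0)_1 ⊗ v1),
   and between left comodules
     (avg f)(v) = θ(v_{-1} ⊗ f(v0)_{-1}) f(v0)_0.
   Ad-invariance of λ gives θ(a1 h ⊗ a2 k) = ε(a) θ(h ⊗ k), the antipode alone
   gives θ(h a1 ⊗ k a2) = ε(a) θ(h ⊗ k), and these make avg preserve left and
   right linearity over a comodule algebra. The other integral condition gives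
   h1 θ(h2 ⊗ k) = θ(h ⊗ k1) k2, which makes avg f colinear, and λ(1) = 1 gives
   θ(h1 ⊗ h2) = ε(h), whence avg f = f for f colinear. On bicomodules the right
   average is followed by the left one, which preserves right colinearity. *)
Require Import Defs.
From HB Require Import structures.
From mathcomp Require Import all_boot all_algebra.

Set Implicit Arguments.
Unset Strict Implicit.
Unset Printing Implicit Defensive.

Import GRing.Theory.
Local Open Scope ring_scope.

(* For the sum case of [tensor_ind]: both sides are additive. *)
Ltac additivity e e' :=
  rewrite !(tpureDl, tpureDr, linearD, mulrDl, mulrDr);
  congr (_ + _); [exact: e | exact: e'].

(** * Rebracketing and contraction of tensors *)

Section Contraction.
Variable K : fieldType.
Implicit Types U V W T : lmodType K.

Lemma tpure_linear V W (v : V) : linear (@tpure K V W v).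
Proof. by case: (tpure_bilin V W). Qed.

HB.instance Definition _ V W (v : V) :=
  GRing.isLinear.Build K W (V ⊗ W)%type *:%R (@tpure K V W v) (tpure_linear v).

(** Inverse rebracketing, used to read coassociativity from the left comodule side. With
    [tmap (tpure u) idfun] as inner map, linearity in the second argument is immediate. *)
Definition tassocV U V W (t : U ⊗ (V ⊗ W)) : (U ⊗ V) ⊗ W :=
  tlift (fun u vw => tmap (tpure u) idfun vw) t.

Lemma tassocV_bilin U V W :
  bilin (fun (u : U) (vw : V ⊗ W) => tmap (tpure u) idfun vw : (U ⊗ V) ⊗ W).
Proof.
split=> [t a u u'|u]; last exact: linearP.
elim/tensor_ind: t => [v w|s t hs ht]; first by rewrite !tmap_pure /= !tpureE.
by rewrite !linearD /= hs ht addrACA.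
Qed.

HB.instance Definition _ U V W :=
  GRing.isLinear.Build K (U ⊗ (V ⊗ W))%type ((U ⊗ V) ⊗ W)%type *:%R
    (@tassocV U V W) (tlift_linear (tassocV_bilin U V W)).

Lemma tassocV_pure U V W (u : U) (v : V) (w : W) :
  tassocV (u ⊗ (v ⊗ w)) = (u ⊗ v) ⊗ w.
Proof. by rewrite /tassocV (tlift_pure _ _ (tassocV_bilin U V W)) tmap_pure. Qed.

Lemma tassocK U V W : cancel (@tassoc K U V W) (@tassocV U V W).
Proof.
move=> t; elim/tensor_ind: t => [s w|s t hs ht]; last by rewrite !linearD /= hs ht.
elim/tensor_ind: s => [u v|s t hs ht]; last by rewrite tpureDl !linearD /= hs ht.
by rewrite tassoc_pure tassocV_pure.
Qed.

(** The maps id ⊗ φ and φ ⊗ id, with V ⊗ K and K ⊗ V identified with V. *)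
Definition ctr V T (phi : {linear T -> K^o}) (t : V ⊗ T) : V :=
  tlift (fun v x => phi x *: v) t.
Definition ctl V T (phi : {linear T -> K^o}) (t : T ⊗ V) : V :=
  tlift (fun x v => phi x *: v) t.

Lemma ctr_bilin V T (phi : {linear T -> K^o}) :
  bilin (fun (v : V) x => phi x *: v).
Proof.
split=> [x|v] a y z; first by rewrite scalerDr !scalerA mulrC.
by rewrite linearP scalerDl scalerA.
Qed.

Lemma ctl_bilin V T (phi : {linear T -> K^o}) :
  bilin (fun x (v : V) => phi x *: v).
Proof. by have [h1 h2] := ctr_bilin V phi; split=> [v|x]; [apply: h2|apply: h1]. Qed.

HB.instance Definition _ V T phi :=
  GRing.isLinear.Build K (V ⊗ T)%type V *:%R (@ctr V T phi)
    (tlift_linear (ctr_bilin V phi)).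
HB.instance Definition _ V T phi :=
  GRing.isLinear.Build K (T ⊗ V)%type V *:%R (@ctl V T phi)
    (tlift_linear (ctl_bilin V phi)).

Lemma ctr_pure V T (phi : {linear T -> K^o}) (v : V) x :
  ctr phi (v ⊗ x) = phi x *: v.
Proof. exact: tlift_pure (ctr_bilin V phi). Qed.

Lemma ctl_pure V T (phi : {linear T -> K^o}) (v : V) x :
  ctl phi (x ⊗ v) = phi x *: v.
Proof. exact: tlift_pure (ctl_bilin V phi). Qed.

End Contraction.

(** * Antipode identities *)

Section Antipode.
Variables (K : fieldType) (H : hopfAlgType K).
Implicit Types h k x y : H.
Local Notation S := (@antipode K H).
Local Notation D := (@comul K H).
Local Notation eps := (@counit K H).
Local Notation HH := (H ⊗ H)%type.

(** The product of the tensor product algebra H ⊗ H, for which Δ is multiplicative. *)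
Definition tmul2 (t : HH ⊗ HH) : HH :=
  tmap (@tmul K H) (@tmul K H) (tinter t).

HB.instance Definition _ :=
  GRing.Linear.copy tmul2 (tmap (@tmul K H) (@tmul K H) \o @tinter K H H H H).

Lemma tmul2_pure x y h k : tmul2 ((x ⊗ y) ⊗ (h ⊗ k)) = (x * h) ⊗ (y * k).
Proof. by rewrite /tmul2 tinter_pure tmap_pure /= !tmul_pure. Qed.

Lemma tmul2A (r s t : HH) :
  tmul2 (r ⊗ tmul2 (s ⊗ t)) = tmul2 (tmul2 (r ⊗ s) ⊗ t).
Proof.
elim/tensor_ind: r => [x x'|? ? e e']; last additivity e e'.
elim/tensor_ind: s => [y y'|? ? e e'];
  last additivity e e'.
elim/tensor_ind: t => [z z'|? ? e e'];
  last additivity e e'.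
by rewrite !tmul2_pure !mulrA.
Qed.

Lemma comulM2 h k : D (h * k) = tmul2 (D h ⊗ D k).
Proof. exact: comulM. Qed.

(** The antipode axioms are stated through [tlift]; this turns them into composites of linear maps,
    on which tensor induction and rewriting work. *)
Lemma tlift_tmul (f g : {linear H -> H}) (t : HH) :
  tlift (fun x y => f x * g y) t = tmul (tmap f g t).
Proof.
have fb : bilin (fun x y : H => f x * g y).
  split=> [y|x] a u v; first by rewrite linearP mulrDl -scalerAl.
  by rewrite linearP mulrDr -scalerAr.
have fD := linear_D (tlift_linear fb).
elim/tensor_ind: t => [x y|s t hs ht]; last by rewrite fD hs ht !linearD.
by rewrite tlift_pure // tmap_pure tmul_pure.
Qed.

Lemma tmul_antipodel h : tmul (tmap S idfun (D h)) = eps h *: 1.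
Proof. by rewrite -antipodel (tlift_tmul S idfun). Qed.

Lemma tmul_antipoder h : tmul (tmap idfun S (D h)) = eps h *: 1.
Proof. by rewrite -antipoder (tlift_tmul idfun S). Qed.

Lemma rcounit_comul h : rcounit_map (D h) = h.
Proof. exact: counitr. Qed.

Lemma lcounit_comul h : lcounit_map (D h) = h.
Proof. exact: counitl. Qed.

(* h1 ⊗ h2 S(h3) = h ⊗ 1. *)
Lemma comul_antipoder h : tmul2 (tmap D (tpure 1 \o S) (D h)) = h ⊗ 1.
Proof.
pose mu : {linear HH -> H} := @tmul K H \o tmap idfun S.
(* Regrouped as id ⊗ [mu] on h1 ⊗ h2 ⊗ h3, so that coassociativity brings h2 S(h3) under the
   antipode axiom. *)
have -> t : tmul2 (tmap D (tpure 1 \o S) t)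
    = tmap idfun mu (tassoc (tmap D idfun t)).
  elim/tensor_ind: t => [x y|? ? e e']; last additivity e e'.
  rewrite !tmap_pure [in LHS]/=.
  elim/tensor_ind: (D x) => [p q|? ? e e'];
    last additivity e e'.
  by rewrite tmul2_pure tassoc_pure tmap_pure /= tmap_pure tmul_pure mulr1.
rewrite comulA.
have -> t : tmap idfun mu (tmap idfun D t) = rcounit_map t ⊗ 1.
  elim/tensor_ind: t => [x y|? ? e e']; last additivity e e'.
  by rewrite !tmap_pure rcounit_pure /= tmul_antipoder !tpureE.
by rewrite rcounit_comul.
Qed.

(* Δ(S h1) (h2 ⊗ 1) = 1 ⊗ S h, the form in which anticomultiplicativity of S is
   needed: expand Δ(S h1) Δ(h2) (1 ⊗ S h3) in two ways. *)
Lemma comul_antipode h : tmul2 (tmap (D \o S) (tpure_at 1) (D h)) = 1 ⊗ S h.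
Proof.
pose nu : {linear (H ⊗ HH)%type -> HH} := tmul2 \o tmap (D \o S) idfun.
pose mu : {linear HH -> HH} := tmul2 \o tmap D (tpure 1 \o S).
have -> t : tmul2 (tmap (D \o S) (tpure_at 1) t)
    = nu (tmap idfun (@tpure_at K H H 1) t).
  elim/tensor_ind: t => [x y|? ? e e']; last additivity e e'.
  by rewrite /nu [RHS]/= !tmap_pure.
(* The factor y ⊗ 1 is expanded into y1 ⊗ y2 S(y3), that is Δ(y1) (1 ⊗ S(y2)). *)
have -> t : tmap idfun (@tpure_at K H H 1) t = tmap idfun (mu \o D) t.
  elim/tensor_ind: t => [x y|? ? e e']; last additivity e e'.
  by rewrite !tmap_pure /= /mu /= comul_antipoder.
have -> t : tmap idfun (mu \o D) t = tmap idfun mu (tmap idfun D t).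
  elim/tensor_ind: t => [x y|? ? e e']; last additivity e e'.
  by rewrite !tmap_pure.
rewrite -comulA.
have -> t : nu (tmap idfun mu (tassoc (tmap D idfun t)))
    = 1 ⊗ S (lcounit_map t).
  elim/tensor_ind: t => [x y|? ? e e']; last additivity e e'.
  rewrite tmap_pure lcounit_pure.
  (* Multiplicativity gives Δ(S p) Δ(q) = Δ(S(p) q), so the antipode axiom applies inside Δ. *)
  have e s : nu (tmap idfun mu (tassoc (s ⊗ y)))
      = tmul2 (D (tmul (tmap S idfun s)) ⊗ (1 ⊗ S y)).
    elim/tensor_ind: s => [p q|? ? e e']; last additivity e e'.
    rewrite tassoc_pure !tmap_pure /nu /mu /= !tmap_pure /= tmul_pure.
    by rewrite comulM2 tmul2A.
  rewrite [LHS]e tmul_antipodel linearZ /= comul1 tpureZl linearZ /= tmul2_pure.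
  by rewrite !mul1r linearZ /= tpureZr.
by rewrite lcounit_comul.
Qed.

(* k1 S(h k2) = ε(k) S(h): expand S(h1) h2 k1 S(h3 k2) in two ways. *)
Lemma mul_antipode_mul h k :
  tmul (tmap idfun S (tmul2 ((1 ⊗ h) ⊗ D k))) = eps k *: S h.
Proof.
pose mu : {linear HH -> H} := @tmul K H \o tmap idfun S.
rewrite -[LHS]/(mu _).
(* This is x ⊗ y ⊗ z ↦ S(x) y k1 S(z k2). *)
pose nu : {linear (H ⊗ HH)%type -> H} :=
  @tmul K H \o tmap S (mu \o tmul2 \o tpure_at (D k)).
have e t : nu (tassoc (tmap D idfun t))
    = mu (tmul2 ((1 ⊗ lcounit_map t) ⊗ D k)).
  elim/tensor_ind: t => [x y|? ? e e']; last additivity e e'.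
  rewrite tmap_pure lcounit_pure.
  have e s : nu (tassoc (s ⊗ y))
      = tmul (tmap S idfun s) * mu (tmul2 ((1 ⊗ y) ⊗ D k)).
    elim/tensor_ind: s => [p q|? ? e e'].
      rewrite tassoc_pure !tmap_pure /nu /= tmap_pure /= !tmul_pure -mulrA.
      congr (_ * _); rewrite /tpure_at.
      elim/tensor_ind: (D k) => [c d|? ? e e'].
        by rewrite !tmul2_pure !tmap_pure !tmul_pure /= mul1r mulrA.
      additivity e e'.
    additivity e e'.
  rewrite [LHS]e tmul_antipodel -scalerAl mul1r.
  by rewrite tpureZr tpureZl !linearZ.
rewrite -[h in LHS]lcounit_comul -e comulA.
(* The other grouping: y1 k1 S(y2 k2) = ε(y k), since y1 k1 ⊗ y2 k2 = Δ(y k). *)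
have -> t : nu (tmap idfun D t) = eps k *: S (rcounit_map t).
  elim/tensor_ind: t => [x y|? ? e1 e1'];
    last additivity e1 e1'.
  rewrite tmap_pure /nu /= tmap_pure /= tmul_pure /tpure_at -comulM2.
  rewrite tmul_antipoder counitM rcounit_pure linearZ /= scalerA mulrC.
  by rewrite -scalerAr mulr1.
by rewrite rcounit_comul.
Qed.

(** Expand S(k1) k2 S(h k3) in two ways: cancelling S(k1) k2 leaves S(h k), while k2 S(h k3) = ε(k2)
    S(h) by [mul_antipode_mul] leaves S(k) S(h). *)
Lemma antipodeM h k : S (h * k) = S k * S h.
Proof.
pose mu : {linear HH -> H} := @tmul K H \o tmap idfun S.
pose nu : {linear (H ⊗ HH)%type -> H} :=
  @tmul K H \o tmap S (mu \o tmul2 \o tpure (1 ⊗ h)).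
have e1 t : nu (tassoc (tmap D idfun t)) = S (h * lcounit_map t).
  elim/tensor_ind: t => [x y|? ? e e'];
    last additivity e e'.
  rewrite tmap_pure lcounit_pure.
  have e s : nu (tassoc (s ⊗ y)) = tmul (tmap S idfun s) * S (h * y).
    elim/tensor_ind: s => [p q|? ? e e'];
      last additivity e e'.
    rewrite tassoc_pure /nu /= !tmap_pure /= tmul2_pure !tmap_pure /=.
    by rewrite !tmul_pure mul1r mulrA.
  by rewrite [LHS]e tmul_antipodel -scalerAl mul1r -scalerAr linearZ.
have e2 t : nu (tmap idfun D t) = S (rcounit_map t) * S h.
  elim/tensor_ind: t => [x y|? ? e e'];
    last additivity e e'.
  rewrite tmap_pure /nu /= tmap_pure /= tmul_pure mul_antipode_mul.
  by rewrite rcounit_pure linearZ /= -scalerAr scalerAl.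
by rewrite -[k in LHS]lcounit_comul -e1 comulA e2 rcounit_comul.
Qed.
End Antipode.

(** * The form θ and its invariance *)

Section Theta.
Variables (K : fieldType) (H : hopfAlgType K) (lambda : {scalar H}).
Hypothesis lambdaP : ad_invariant_integral lambda.
Local Notation S := (@antipode K H).
Local Notation D := (@comul K H).
Local Notation HH := (H ⊗ H)%type.

Definition theta (t : HH) : K^o := lambda (tmul (tmap idfun S t)).

Lemma theta_linear : linear theta.
Proof. by move=> a s t; rewrite /theta !linearP. Qed.

HB.instance Definition _ :=
  GRing.isLinear.Build K HH K^o *:%R theta theta_linear.

Lemma theta_pure (h k : H) : theta (h ⊗ k) = lambda (h * S k).
Proof. by rewrite /theta tmap_pure tmul_pure. Qed.

Lemma theta_comul h : theta (D h) = counit h.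
Proof. by rewrite /theta tmul_antipoder linearZ /= (Defs.integral1 lambdaP) mulr1. Qed.

(** Since S reverses products, θ(a1 h ⊗ a2 k) = λ(a1 (h S(k)) S(a2)), and ad-invariance applies at x
    = h S(k). *)
Lemma theta_mull a t : theta (tmul2 (D a ⊗ t)) = counit a * theta t.
Proof.
elim/tensor_ind: t => [h k|? ? e e']; last additivity e e'.
rewrite theta_pure -(integral_ad lambdaP).
have fb : bilin (fun x y : H => lambda (x * (h * S k) * S y) : K^o).
  split=> [y|x] b u v.
    by rewrite !mulrDl -!scalerAl linearP.
  by rewrite linearP mulrDr -scalerAr linearP.
have fD := linear_D (tlift_linear fb).
elim/tensor_ind: (D a) => [x y|s t e e'].
  by rewrite tlift_pure // tmul2_pure theta_pure antipodeM !mulrA.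
by rewrite fD tpureDl !linearD /= e e'.
Qed.

(** Already before applying λ, h a1 S(k a2) = ε(a) h S(k) by [mul_antipode_mul]. *)
Lemma theta_mulr a t : theta (tmul2 (t ⊗ D a)) = counit a * theta t.
Proof.
elim/tensor_ind: t => [h k|? ? e e']; last additivity e e'.
have -> s : theta (tmul2 ((h ⊗ k) ⊗ s))
    = lambda (h * tmul (tmap idfun S (tmul2 ((1 ⊗ k) ⊗ s)))).
  elim/tensor_ind: s => [x y|? ? e e']; last additivity e e'.
  rewrite !tmul2_pure theta_pure tmap_pure tmul_pure /=.
  by rewrite mul1r !mulrA.
by rewrite mul_antipode_mul -scalerAr linearZ theta_pure.
Qed.

(* h1 θ(h2 ⊗ k) = θ(h ⊗ k1) k2: by [comul_antipode], the left side is
   (h S(k1))_1 k2 λ((h S(k1))_2). *)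
Lemma theta_swap h k :
  ctr (theta \o tpure_at k) (D h) = ctl (theta \o tpure h) (D k).
Proof.
(* λ repackaged as a linear map into [K^o], the form that contractions take; the first integral
   condition then reads as a contraction of Δ. *)
pose lam : {linear H -> K^o} := HB.pack (lambda : H -> K^o)
  (GRing.isLinear.Build K H K^o *:%R (lambda : H -> K^o) (linearP lambda)).
have lamP x : ctr lam (D x) = lambda x *: 1 := integral_colinear lambdaP x.
have -> s : ctr (theta \o tpure_at k) s = ctr lam (tmul2 (s ⊗ (1 ⊗ S k))).
  elim/tensor_ind: s => [x y|? ? e e']; last additivity e e'.
  by rewrite tmul2_pure !ctr_pure /= /tpure_at theta_pure mulr1.
rewrite -comul_antipode.
elim/tensor_ind: (D k) => [x y|? ? e e']; last additivity e e'.
rewrite tmap_pure /= /tpure_at tmul2A -comulM2 ctl_pure /= theta_pure.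
have -> s : ctr lam (tmul2 (s ⊗ (y ⊗ 1))) = ctr lam s * y.
  elim/tensor_ind: s => [p q|? ? e e']; last additivity e e'.
  by rewrite tmul2_pure !ctr_pure mulr1; apply: scalerAl.
by rewrite lamP -[LHS]scalerAl mul1r.
Qed.

End Theta.

(** * Averages of linear maps between comodules *)

Section Averaging.
Variables (K : fieldType) (H : hopfAlgType K).
Local Notation D := (@comul K H).
Local Notation eps := (@counit K H).
Local Notation HH := (H ⊗ H)%type.
(** [th] stands for θ, entering through the four identities assumed below. *)
Variable th : {linear HH -> K^o}.
Hypothesis th_comul : forall h, th (D h) = eps h.
Hypothesis th_mull : forall a t, th (tmul2 (D a ⊗ t)) = eps a * th t.
Hypothesis th_mulr : forall a t, th (tmul2 (t ⊗ D a)) = eps a * th t.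
Hypothesis th_swap : forall h k,
  ctr (th \o tpure_at k) (D h) = ctl (th \o tpure h) (D k).
Implicit Types A V W T : lmodType K.

Lemma ctr_map V W T (phi : {linear T -> K^o}) (f : {linear V -> W}) t :
  ctr phi (tmap f idfun t) = f (ctr phi t).
Proof.
elim/tensor_ind: t => [v x|? ? e e']; last additivity e e'.
by rewrite tmap_pure !ctr_pure linearZ.
Qed.

Lemma ctl_map V W T (phi : {linear T -> K^o}) (f : {linear V -> W}) t :
  ctl phi (tmap idfun f t) = f (ctl phi t).
Proof.
elim/tensor_ind: t => [v x|? ? e e']; last additivity e e'.
by rewrite tmap_pure !ctl_pure linearZ.
Qed.

(** * Right comodules *)

Section Right.

(** By coassociativity the left side is v0 θ(v1 ⊗ v2) = v0 ε(v1). *)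
Lemma ctr_coact V (rV : rcoaction H V) v :
  ctr th (tassoc (tmap rV idfun (rV v))) = v.
Proof.
rewrite rcoactA -[RHS](rcoact1 rV) -[RHS]/(rcounit_map (rV v)).
elim/tensor_ind: (rcoact rV v) => [w x|? ? e e']; last additivity e e'.
by rewrite tmap_pure ctr_pure th_comul rcounit_pure.
Qed.

(** The average before the coaction of V is applied. Being linear on all of V ⊗ H, it allows
    induction on a tensor in place of v0 ⊗ v1. *)
Definition spreadr V W (rW : rcoaction H W) (f : {linear V -> W}) :
    {linear (V ⊗ H)%type -> W} :=
  ctr th \o @tassoc K W H H \o tmap (rW \o f) idfun.

Definition avgr V W (rV : rcoaction H V) (rW : rcoaction H W)
    (f : {linear V -> W}) : {linear V -> W} := spreadr rW f \o rV.

Lemma spreadr_tassoc V W (rW : rcoaction H W) (f : {linear V -> W}) v k :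
  spreadr rW f (v ⊗ k) = ctr th (tassoc (rW (f v) ⊗ k)).
Proof. by rewrite /spreadr /= tmap_pure. Qed.

Lemma ctr_tassoc W k u :
  ctr th (tassoc ((u : W ⊗ H) ⊗ k)) = ctr (th \o tpure_at k) u.
Proof.
elim/tensor_ind: u => [w h|? ? e e']; last additivity e e'.
by rewrite tassoc_pure !ctr_pure.
Qed.

Lemma spreadr_pure V W (rW : rcoaction H W) (f : {linear V -> W}) v k :
  spreadr rW f (v ⊗ k) = ctr (th \o tpure_at k) (rW (f v)).
Proof. by rewrite spreadr_tassoc ctr_tassoc. Qed.

(** Colinearity of [f] and [h] carries the coactions past them, and contraction commutes with
    [h]. *)
Lemma avgr_natural V V' W W' (rV : rcoaction H V) (rV' : rcoaction H V')
    (rW : rcoaction H W) (rW' : rcoaction H W') (f : {linear V' -> V})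
    (g : {linear V -> W}) (h : {linear W -> W'}) :
  rcolinear rV' rV f -> rcolinear rW rW' h ->
  avgr rV' rW' (h \o (g \o f)) =1 h \o (avgr rV rW g \o f).
Proof.
move=> fP hP v; rewrite /avgr /= -![ctr _ _]/(spreadr _ _ _) fP.
elim/tensor_ind: (rcoact rV' v) => [w k|? ? e e']; last additivity e e'.
by rewrite tmap_pure !spreadr_pure /= hP ctr_map.
Qed.

(** For colinear f the average is f(v0) θ(v1 ⊗ v2), which [ctr_coact] evaluates. *)
Lemma avgr_id V W (rV : rcoaction H V) (rW : rcoaction H W)
    (f : {linear V -> W}) : rcolinear rV rW f -> avgr rV rW f =1 f.
Proof.
move=> fP v; rewrite -[in RHS](ctr_coact rV v) -[LHS]/(spreadr rW f (rV v)).
elim/tensor_ind: (rcoact rV v) => [w k|? ? e e']; last additivity e e'.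
by rewrite spreadr_pure fP ctr_map tmap_pure ctr_tassoc.
Qed.

(** Coassociativity: w0 φ(w1) has coaction w0 ⊗ w1 φ(w2). *)
Lemma rcoact_ctr W (rW : rcoaction H W) (phi : {linear H -> K^o}) w :
  rW (ctr phi (rW w)) = tmap idfun (ctr phi \o D) (rW w).
Proof.
have -> u : rW (ctr phi u) = tmap idfun (ctr phi) (tassoc (tmap rW idfun u)).
  elim/tensor_ind: u => [x k|? ? e e']; last additivity e e'.
  rewrite ctr_pure tmap_pure linearZ /=.
  elim/tensor_ind: (rcoact rW x) => [y h|? ? e e'].
    by rewrite tassoc_pure tmap_pure /= ctr_pure tpureZr.
  by rewrite scalerDr tpureDl !linearD /= e e'.
rewrite rcoactA.
elim/tensor_ind: (rcoact rW w) => [x k|? ? e e']; last additivity e e'.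
by rewrite !tmap_pure.
Qed.

(** The coaction of the average is f(v0)_0 ⊗ f(v0)_1 θ(f(v0)_2 ⊗ v1); [th_swap] turns it into
    f(v0)_0 θ(f(v0)_1 ⊗ v1) ⊗ v2. *)
Lemma avgr_rcolinear V W (rV : rcoaction H V) (rW : rcoaction H W)
    (f : {linear V -> W}) : rcolinear rV rW (avgr rV rW f).
Proof.
(* [n] is (w ⊗ h) ⊗ (y ⊗ z) ↦ θ(h ⊗ y) w ⊗ z. *)
move=> v; pose n : {linear ((W ⊗ H) ⊗ HH)%type -> (W ⊗ H)%type} :=
  tmap (ctr th \o @tassoc K W H H) idfun \o @tassocV K (W ⊗ H)%type H H.
rewrite -[avgr rV rW f v]/(spreadr rW f (rV v)).
have -> t : tmap (avgr rV rW f) idfun t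
    = tmap (spreadr rW f) idfun (tassocV (tassoc (tmap rV idfun t))).
  by rewrite tassocK tmap_comp.
rewrite rcoactA.
elim/tensor_ind: (rcoact rV v) => [w k|? ? e e']; last additivity e e'.
rewrite spreadr_pure rcoact_ctr tmap_pure.
have -> r : tmap (spreadr rW f) idfun (tassocV (w ⊗ r)) = n (rW (f w) ⊗ r).
  elim/tensor_ind: r => [x y|? ? e e']; last additivity e e'.
  by rewrite /n /= !tassocV_pure !tmap_pure spreadr_tassoc.
elim/tensor_ind: (rcoact rW (f w)) => [x h|? ? e e'];
  last additivity e e'.
rewrite tmap_pure /= th_swap.
elim/tensor_ind: (D k) => [y z|? ? e e']; last additivity e e'.
by rewrite /n /= tassocV_pure tmap_pure /= tassoc_pure ctr_pure ctl_pure !tpureE.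
Qed.

(** The average at a v is a0 f(v0)_0 θ(a1 f(v0)_1 ⊗ a2 v1), and [th_mull] removes a1 and a2. *)
Lemma avgr_lact A V W (rA : rcoaction H A) (rV : rcoaction H V)
    (rW : rcoaction H W) (l : {linear (A ⊗ V)%type -> V})
    (l' : {linear (A ⊗ W)%type -> W}) (f : {linear V -> W}) :
  rcolinear (rcodiag rA rV) rV l -> rcolinear (rcodiag rA rW) rW l' ->
  (forall a v, f (l (a ⊗ v)) = l' (a ⊗ f v)) ->
  forall a v, avgr rV rW f (l (a ⊗ v)) = l' (a ⊗ avgr rV rW f v).
Proof.
move=> lP l'P fP a v.
(* [G] is (b ⊗ s) ⊗ (w ⊗ t) ↦ θ(s t) l'(b ⊗ w). *)
pose G : {linear ((A ⊗ HH) ⊗ (W ⊗ HH))%type -> W} :=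
  ctr th \o (tmap l' (@tmul2 K H) \o @tinter K A HH W HH).
rewrite -![avgr rV rW f _]/(spreadr rW f (rV _)) lP.
rewrite -[rcodiag _ _ _]/(tmap idfun (@tmul K H) (tinter (tmap rA rV (a ⊗ v)))).
rewrite tmap_pure.
have -> s t : spreadr rW f (tmap l idfun (tmap idfun (@tmul K H) (tinter (s ⊗ t))))
    = G (tassoc (tmap rA idfun s) ⊗ tassoc (tmap (rW \o f) idfun t)).
  elim/tensor_ind: s => [b x|? ? e e']; last additivity e e'.
  elim/tensor_ind: t => [w y|? ? e e']; last additivity e e'.
  rewrite tinter_pure !tmap_pure spreadr_tassoc /= fP l'P.
  rewrite -[rcodiag _ _ _]/(tmap idfun (@tmul K H)
    (tinter (tmap rA rW (b ⊗ f w)))) tmap_pure tmul_pure.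
  elim/tensor_ind: (rcoact rA b) => [c z|? ? e e']; last additivity e e'.
  elim/tensor_ind: (rcoact rW (f w)) => [w' h|? ? e e']; last additivity e e'.
  rewrite tinter_pure !tmap_pure /= tmul_pure !tassoc_pure tinter_pure.
  by rewrite tmap_pure /= tmul2_pure.
rewrite rcoactA -[spreadr _ _ _]/(ctr th (tassoc _)).
have -> s p : G (tmap idfun D s ⊗ p) = l' (rcounit_map s ⊗ ctr th p).
  elim/tensor_ind: s => [b x|? ? e e']; last additivity e e'.
  elim/tensor_ind: p => [w t|? ? e e']; last additivity e e'.
  rewrite tmap_pure rcounit_pure /G /= tinter_pure tmap_pure !ctr_pure.
  by rewrite th_mull !tpureE !linearZ /= scalerA mulrC.
by rewrite /rcounit_map rcoact1.
Qed.

(** The average at v a is f(v0)_0 a0 θ(f(v0)_1 a1 ⊗ v1 a2), and [th_mulr] removes a1 and a2. *)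
Lemma avgr_ract A V W (rA : rcoaction H A) (rV : rcoaction H V)
    (rW : rcoaction H W) (r : {linear (V ⊗ A)%type -> V})
    (r' : {linear (W ⊗ A)%type -> W}) (f : {linear V -> W}) :
  rcolinear (rcodiag rV rA) rV r -> rcolinear (rcodiag rW rA) rW r' ->
  (forall a v, f (r (v ⊗ a)) = r' (f v ⊗ a)) ->
  forall a v, avgr rV rW f (r (v ⊗ a)) = r' (avgr rV rW f v ⊗ a).
Proof.
move=> rP r'P fP a v.
pose G : {linear ((W ⊗ HH) ⊗ (A ⊗ HH))%type -> W} :=
  ctr th \o (tmap r' (@tmul2 K H) \o @tinter K W HH A HH).
rewrite -![avgr rV rW f _]/(spreadr rW f (rV _)) rP.
rewrite -[rcodiag _ _ _]/(tmap idfun (@tmul K H) (tinter (tmap rV rA (v ⊗ a)))).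
rewrite tmap_pure.
have -> s t : spreadr rW f (tmap r idfun (tmap idfun (@tmul K H) (tinter (t ⊗ s))))
    = G (tassoc (tmap (rW \o f) idfun t) ⊗ tassoc (tmap rA idfun s)).
  elim/tensor_ind: s => [b x|? ? e e']; last additivity e e'.
  elim/tensor_ind: t => [w y|? ? e e']; last additivity e e'.
  rewrite tinter_pure !tmap_pure spreadr_tassoc /= fP r'P.
  rewrite -[rcodiag _ _ _]/(tmap idfun (@tmul K H)
    (tinter (tmap rW rA (f w ⊗ b)))) tmap_pure tmul_pure.
  elim/tensor_ind: (rcoact rA b) => [c z|? ? e e']; last additivity e e'.
  elim/tensor_ind: (rcoact rW (f w)) => [w' h|? ? e e']; last additivity e e'.
  rewrite tinter_pure !tmap_pure /= tmul_pure !tassoc_pure tinter_pure.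
  by rewrite tmap_pure /= tmul2_pure.
rewrite rcoactA -[spreadr _ _ _]/(ctr th (tassoc _)).
have -> s p : G (p ⊗ tmap idfun D s) = r' (ctr th p ⊗ rcounit_map s).
  elim/tensor_ind: s => [b x|? ? e e']; last additivity e e'.
  elim/tensor_ind: p => [w t|? ? e e']; last additivity e e'.
  rewrite tmap_pure rcounit_pure /G /= tinter_pure tmap_pure !ctr_pure.
  by rewrite th_mulr !tpureE !linearZ /= scalerA.
by rewrite /rcounit_map rcoact1.
Qed.

End Right.

(** * Left comodules *)

Section Left.

Lemma ctl_coact V (lV : lcoaction H V) v :
  ctl th (tassocV (tmap idfun lV (lV v))) = v.
Proof.
rewrite -lcoactA tassocK -[RHS](lcoact1 lV) -[RHS]/(lcounit_map (lV v)).
elim/tensor_ind: (lcoact lV v) => [x w|? ? e e']; last additivity e e'.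
by rewrite tmap_pure ctl_pure th_comul lcounit_pure.
Qed.

Definition spreadl V W (lW : lcoaction H W) (f : {linear V -> W}) :
    {linear (H ⊗ V)%type -> W} :=
  ctl th \o @tassocV K H H W \o tmap idfun (lW \o f).

Definition avgl V W (lV : lcoaction H V) (lW : lcoaction H W)
    (f : {linear V -> W}) : {linear V -> W} := spreadl lW f \o lV.

Lemma spreadl_tassocV V W (lW : lcoaction H W) (f : {linear V -> W}) v k :
  spreadl lW f (k ⊗ v) = ctl th (tassocV (k ⊗ lW (f v))).
Proof. by rewrite /spreadl /= tmap_pure. Qed.

Lemma ctl_tassocV W k u :
  ctl th (tassocV (k ⊗ (u : H ⊗ W))) = ctl (th \o tpure k) u.
Proof.
elim/tensor_ind: u => [h w|? ? e e']; last additivity e e'.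
by rewrite tassocV_pure !ctl_pure.
Qed.

Lemma spreadl_pure V W (lW : lcoaction H W) (f : {linear V -> W}) v k :
  spreadl lW f (k ⊗ v) = ctl (th \o tpure k) (lW (f v)).
Proof. by rewrite spreadl_tassocV ctl_tassocV. Qed.

Lemma avgl_natural V V' W W' (lV : lcoaction H V) (lV' : lcoaction H V')
    (lW : lcoaction H W) (lW' : lcoaction H W') (f : {linear V' -> V})
    (g : {linear V -> W}) (h : {linear W -> W'}) :
  lcolinear lV' lV f -> lcolinear lW lW' h ->
  avgl lV' lW' (h \o (g \o f)) =1 h \o (avgl lV lW g \o f).
Proof.
move=> fP hP v; rewrite /avgl /= -![ctl _ _]/(spreadl _ _ _) fP.
elim/tensor_ind: (lcoact lV' v) => [k w|? ? e e']; last additivity e e'.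
by rewrite tmap_pure !spreadl_pure /= hP ctl_map.
Qed.

Lemma avgl_id V W (lV : lcoaction H V) (lW : lcoaction H W)
    (f : {linear V -> W}) : lcolinear lV lW f -> avgl lV lW f =1 f.
Proof.
move=> fP v; rewrite -[in RHS](ctl_coact lV v) -[LHS]/(spreadl lW f (lV v)).
elim/tensor_ind: (lcoact lV v) => [k w|? ? e e']; last additivity e e'.
by rewrite spreadl_pure fP ctl_map tmap_pure ctl_tassocV.
Qed.

(** Coassociativity: φ(w_{-1}) w0 has coaction φ(w_{-2}) w_{-1} ⊗ w0. *)
Lemma lcoact_ctl W (lW : lcoaction H W) (phi : {linear H -> K^o}) w :
  lW (ctl phi (lW w)) = tmap (ctl phi \o D) idfun (lW w).
Proof.
have -> u : lW (ctl phi u) = tmap (ctl phi) idfun (tassocV (tmap idfun lW u)).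
  elim/tensor_ind: u => [k x|? ? e e']; last additivity e e'.
  rewrite ctl_pure tmap_pure linearZ /=.
  elim/tensor_ind: (lcoact lW x) => [h y|? ? e e'].
    by rewrite tassocV_pure tmap_pure /= ctl_pure tpureZl.
  by rewrite scalerDr tpureDr !linearD /= e e'.
rewrite -lcoactA tassocK.
elim/tensor_ind: (lcoact lW w) => [k x|? ? e e']; last additivity e e'.
by rewrite !tmap_pure.
Qed.

(** Here [th_swap] is read backwards: θ(v_{-1} ⊗ f(v0)_{-2}) f(v0)_{-1} ⊗ f(v0)_0 becomes v_{-2}
    θ(v_{-1} ⊗ f(v0)_{-1}) ⊗ f(v0)_0. *)
Lemma avgl_lcolinear V W (lV : lcoaction H V) (lW : lcoaction H W)
    (f : {linear V -> W}) : lcolinear lV lW (avgl lV lW f).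
Proof.
move=> v; pose n : {linear (HH ⊗ (H ⊗ W))%type -> (H ⊗ W)%type} :=
  tmap idfun (ctl th \o @tassocV K H H W) \o @tassoc K H H (H ⊗ W)%type.
rewrite -[avgl lV lW f v]/(spreadl lW f (lV v)).
have -> t : tmap idfun (avgl lV lW f) t
    = tmap idfun (spreadl lW f) (tmap idfun lV t) by rewrite tmap_comp.
rewrite -lcoactA.
elim/tensor_ind: (lcoact lV v) => [k w|? ? e e']; last additivity e e'.
rewrite spreadl_pure lcoact_ctl tmap_pure.
have -> r : tmap idfun (spreadl lW f) (tassoc (r ⊗ w)) = n (r ⊗ lW (f w)).
  elim/tensor_ind: r => [x y|? ? e e']; last additivity e e'.
  by rewrite /n /= !tassoc_pure !tmap_pure spreadl_tassocV.
elim/tensor_ind: (lcoact lW (f w)) => [h x|? ? e e']; last additivity e e'.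
rewrite tmap_pure /= -th_swap.
elim/tensor_ind: (D k) => [y z|? ? e e']; last additivity e e'.
by rewrite /n /= tassoc_pure tmap_pure /= tassocV_pure ctr_pure ctl_pure !tpureE.
Qed.

(** The average at a v is θ(a_{-2} v_{-1} ⊗ a_{-1} f(v0)_{-1}) a0 f(v0)_0, so [th_mull] applies. *)
Lemma avgl_lact A V W (lA : lcoaction H A) (lV : lcoaction H V)
    (lW : lcoaction H W) (l : {linear (A ⊗ V)%type -> V})
    (l' : {linear (A ⊗ W)%type -> W}) (f : {linear V -> W}) :
  lcolinear (lcodiag lA lV) lV l -> lcolinear (lcodiag lA lW) lW l' ->
  (forall a v, f (l (a ⊗ v)) = l' (a ⊗ f v)) ->
  forall a v, avgl lV lW f (l (a ⊗ v)) = l' (a ⊗ avgl lV lW f v).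
Proof.
move=> lP l'P fP a v.
pose G : {linear ((HH ⊗ A) ⊗ (HH ⊗ W))%type -> W} :=
  ctl th \o (tmap (@tmul2 K H) l' \o @tinter K HH A HH W).
rewrite -![avgl lV lW f _]/(spreadl lW f (lV _)) lP.
rewrite -[lcodiag _ _ _]/(tmap (@tmul K H) idfun (tinter (tmap lA lV (a ⊗ v)))).
rewrite tmap_pure.
have -> s t : spreadl lW f (tmap idfun l (tmap (@tmul K H) idfun (tinter (s ⊗ t))))
    = G (tassocV (tmap idfun lA s) ⊗ tassocV (tmap idfun (lW \o f) t)).
  elim/tensor_ind: s => [x b|? ? e e']; last additivity e e'.
  elim/tensor_ind: t => [y w|? ? e e']; last additivity e e'.
  rewrite tinter_pure !tmap_pure spreadl_tassocV /= fP l'P.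
  rewrite -[lcodiag _ _ _]/(tmap (@tmul K H) idfun
    (tinter (tmap lA lW (b ⊗ f w)))) tmap_pure tmul_pure.
  elim/tensor_ind: (lcoact lA b) => [z c|? ? e e']; last additivity e e'.
  elim/tensor_ind: (lcoact lW (f w)) => [h w'|? ? e e']; last additivity e e'.
  rewrite tinter_pure !tmap_pure /= tmul_pure !tassocV_pure tinter_pure.
  by rewrite tmap_pure /= tmul2_pure.
rewrite -lcoactA tassocK -[spreadl _ _ _]/(ctl th (tassocV _)).
have -> s p : G (tmap D idfun s ⊗ p) = l' (lcounit_map s ⊗ ctl th p).
  elim/tensor_ind: s => [x b|? ? e e']; last additivity e e'.
  elim/tensor_ind: p => [t w|? ? e e']; last additivity e e'.
  rewrite tmap_pure lcounit_pure /G /= tinter_pure tmap_pure !ctl_pure.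
  by rewrite th_mull !tpureE !linearZ /= scalerA mulrC.
by rewrite /lcounit_map lcoact1.
Qed.

(** The average at v a is θ(v_{-1} a_{-2} ⊗ f(v0)_{-1} a_{-1}) f(v0)_0 a0, so [th_mulr] applies. *)
Lemma avgl_ract A V W (lA : lcoaction H A) (lV : lcoaction H V)
    (lW : lcoaction H W) (r : {linear (V ⊗ A)%type -> V})
    (r' : {linear (W ⊗ A)%type -> W}) (f : {linear V -> W}) :
  lcolinear (lcodiag lV lA) lV r -> lcolinear (lcodiag lW lA) lW r' ->
  (forall a v, f (r (v ⊗ a)) = r' (f v ⊗ a)) ->
  forall a v, avgl lV lW f (r (v ⊗ a)) = r' (avgl lV lW f v ⊗ a).
Proof.
move=> rP r'P fP a v.
pose G : {linear ((HH ⊗ W) ⊗ (HH ⊗ A))%type -> W} :=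
  ctl th \o (tmap (@tmul2 K H) r' \o @tinter K HH W HH A).
rewrite -![avgl lV lW f _]/(spreadl lW f (lV _)) rP.
rewrite -[lcodiag _ _ _]/(tmap (@tmul K H) idfun (tinter (tmap lV lA (v ⊗ a)))).
rewrite tmap_pure.
have -> s t : spreadl lW f (tmap idfun r (tmap (@tmul K H) idfun (tinter (t ⊗ s))))
    = G (tassocV (tmap idfun (lW \o f) t) ⊗ tassocV (tmap idfun lA s)).
  elim/tensor_ind: s => [x b|? ? e e']; last additivity e e'.
  elim/tensor_ind: t => [y w|? ? e e']; last additivity e e'.
  rewrite tinter_pure !tmap_pure spreadl_tassocV /= fP r'P.
  rewrite -[lcodiag _ _ _]/(tmap (@tmul K H) idfun
    (tinter (tmap lW lA (f w ⊗ b)))) tmap_pure tmul_pure.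
  elim/tensor_ind: (lcoact lA b) => [z c|? ? e e']; last additivity e e'.
  elim/tensor_ind: (lcoact lW (f w)) => [h w'|? ? e e']; last additivity e e'.
  rewrite tinter_pure !tmap_pure /= tmul_pure !tassocV_pure tinter_pure.
  by rewrite tmap_pure /= tmul2_pure.
rewrite -lcoactA tassocK -[spreadl _ _ _]/(ctl th (tassocV _)).
have -> s p : G (p ⊗ tmap D idfun s) = r' (ctl th p ⊗ lcounit_map s).
  elim/tensor_ind: s => [x b|? ? e e']; last additivity e e'.
  elim/tensor_ind: p => [t w|? ? e e']; last additivity e e'.
  rewrite tmap_pure lcounit_pure /G /= tinter_pure tmap_pure !ctl_pure.
  by rewrite th_mulr !tpureE !linearZ /= scalerA.
by rewrite /lcounit_map lcoact1.
Qed.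

End Left.

(** * Bicomodules *)

Section TwoSided.

(** The two coactions commute, so contracting the left one commutes with the right one. *)
Lemma rcoact_ctl W (bW : bicoaction H W) (phi : {linear H -> K^o}) w :
  bicoactr bW (ctl phi (bicoactl bW w))
  = tmap (ctl phi \o bicoactl bW) idfun (bicoactr bW w).
Proof.
have -> u : bicoactr bW (ctl phi u)
    = tmap (ctl phi) idfun (tassocV (tmap idfun (bicoactr bW) u)).
  elim/tensor_ind: u => [k x|? ? e e']; last additivity e e'.
  rewrite ctl_pure tmap_pure linearZ /=.
  elim/tensor_ind: (rcoact (bicoactr bW) x) => [y h|? ? e e'].
    by rewrite tassocV_pure tmap_pure /= ctl_pure tpureZl.
  by rewrite scalerDr tpureDr !linearD /= e e'.
by rewrite -bicoactA tassocK tmap_comp.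
Qed.

(** Left averaging is built from f and the left coactions, all compatible with the right
    coactions. *)
Lemma avgl_rcolinear V W (bV : bicoaction H V) (bW : bicoaction H W)
    (f : {linear V -> W}) :
  rcolinear (bicoactr bV) (bicoactr bW) f ->
  rcolinear (bicoactr bV) (bicoactr bW) (avgl (bicoactl bV) (bicoactl bW) f).
Proof.
move=> fP v; set g := spreadl (bicoactl bW) f.
rewrite -[avgl _ _ f v]/(g (bicoactl bV v)).
have -> t : tmap (avgl (bicoactl bV) (bicoactl bW) f) idfun t
    = tmap g idfun (tassocV (tassoc (tmap (bicoactl bV) idfun t))).
  by rewrite tassocK tmap_comp.
rewrite bicoactA.
elim/tensor_ind: (lcoact (bicoactl bV) v) => [k w|? ? e e']; last additivity e e'.
rewrite /g spreadl_pure rcoact_ctl fP tmap_pure /=.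
elim/tensor_ind: (rcoact (bicoactr bV) w) => [x h|? ? e e']; last additivity e e'.
by rewrite tassocV_pure !tmap_pure /= -[ctl th _]/(spreadl _ _ _) spreadl_pure.
Qed.

End TwoSided.

End Averaging.

(** * Averaging operators on a monoidal category, and separability from them *)

Record averaging (K : fieldType) (C : moncat K) := Averaging {
  avg : forall V W : lmodType K,
    mstr C V -> mstr C W -> {linear V -> W} -> {linear V -> W};
  avg_mor : forall (V W : lmodType K) (s : mstr C V) (t : mstr C W) f,
    mmor s t (avg s t f);
  avg_id : forall (V W : lmodType K) (s : mstr C V) (t : mstr C W) f,
    mmor s t f -> avg s t f =1 f;
  avg_natural : forall (V V' W W' : lmodType K) (s : mstr C V) (s' : mstr C V')
      (t : mstr C W) (t' : mstr C W') (f : {linear V' -> V})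
      (g : {linear V -> W}) (h : {linear W -> W'}),
    mmor s' s f -> mmor t t' h ->
    avg s' t' (h \o (g \o f)) =1 h \o (avg s t g \o f);
  avg_lact : forall (A V W : lmodType K) (a : mstr C A) (s : mstr C V)
      (t : mstr C W) (l : {linear (A ⊗ V)%type -> V})
      (l' : {linear (A ⊗ W)%type -> W}) (f : {linear V -> W}),
    mmor (mtens a s) s l -> mmor (mtens a t) t l' ->
    (forall x v, f (l (x ⊗ v)) = l' (x ⊗ f v)) ->
    forall x v, avg s t f (l (x ⊗ v)) = l' (x ⊗ avg s t f v);
  avg_ract : forall (A V W : lmodType K) (a : mstr C A) (s : mstr C V)
      (t : mstr C W) (r : {linear (V ⊗ A)%type -> V})
      (r' : {linear (W ⊗ A)%type -> W}) (f : {linear V -> W}),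
    mmor (mtens s a) s r -> mmor (mtens t a) t r' ->
    (forall x v, f (r (v ⊗ x)) = r' (f v ⊗ x)) ->
    forall x v, avg s t f (r (v ⊗ x)) = r' (avg s t f v ⊗ x)
}.

(** The average of a bimodule map is again one and a morphism of [C]; naturality and [avg_id] make
    averaging a natural left inverse of the forgetful map on morphisms. *)
Lemma averaging_separable (K : fieldType) (C : moncat K) (P : averaging C)
  (A : algebra_in C) : separable (forget A).
Proof.
pose avg_hom (M N : bimodule_in A) (g : bimodule_hom M N) :
    bimodule_in_hom M N :=
  BimoduleInHom (in_bim_hom := BimoduleHom
      (avg_lact P (lact_mor M) (lact_mor N) (bim_map_lact g))
      (avg_ract P (ract_mor M) (ract_mor N) (bim_map_ract g)))
    (avg_mor P (bim_str M) (bim_str N) (bim_map g)).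
exists avg_hom; split=> [M M' N N' f h g|M N f];
  apply/bimodule_in_hom_ext/bimodule_hom_ext.
  exact: (avg_natural P (bim_map g) (bim_map_mor f) (bim_map_mor h)).
exact: (avg_id P (bim_map_mor f)).
Qed.

(** * Averaging operators for right, left and two-sided comodules *)

Section ComoduleAveragings.
Variables (K : fieldType) (H : hopfAlgType K) (lambda : {scalar H}).
Hypothesis lambdaP : ad_invariant_integral lambda.
Let tC := theta_comul lambdaP.
Let tl := theta_mull lambdaP.
Let tr := theta_mulr lambda.
Let ts := theta_swap lambdaP.

Definition rcomod_averaging : averaging (rcomod H) :=
  @Averaging K (rcomod H) (avgr (theta lambda)) (avgr_rcolinear ts)
    (avgr_id tC) (@avgr_natural _ _ _) (avgr_lact tl) (avgr_ract tr).

Definition lcomod_averaging : averaging (lcomod H) :=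
  @Averaging K (lcomod H) (avgl (theta lambda)) (avgl_lcolinear ts)
    (avgl_id tC) (@avgl_natural _ _ _) (avgl_lact tl) (avgl_ract tr).

Definition bicomod_averaging : averaging (bicomod H).
Proof.
exists (fun V W (bV : bicoaction H V) (bW : bicoaction H W) f =>
  avgl (theta lambda) (bicoactl bV) (bicoactl bW)
    (avgr (theta lambda) (bicoactr bV) (bicoactr bW) f)).
- move=> V W bV bW f; split; first exact: avgl_lcolinear.
  exact/avgl_rcolinear/avgr_rcolinear.
- move=> V W bV bW f [fl fr].
  (* Pointwise equality is upgraded to equality of linear maps, so that the inner average can be
     rewritten under [avgl]. *)
  by rewrite (linear_ext (avgr_id tC fr)); apply: avgl_id fl.
- move=> V V' W W' bV bV' bW bW' f g h [fl fr] [hl hr].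
  rewrite (linear_ext (avgr_natural (theta lambda) g fr hr)).
  exact: avgl_natural fl hl.
- move=> A V W bA bV bW l l' f [ll lr] [ll' lr'] fP.
  exact: (avgl_lact tl ll ll' (avgr_lact tl lr lr' fP)).
- move=> A V W bA bV bW r r' f [rl rr] [rl' rr'] fP.
  exact: (avgl_ract tr rl rl' (avgr_ract tr rr rr' fP)).
Defined.

End ComoduleAveragings.

Theorem lemma3p11 (K : fieldType) (H : hopfAlgType K)
  (hlambda : exists lambda : {scalar H}, ad_invariant_integral lambda) :
  [/\ forall A : algebra_in (rcomod H), separable (forget A),
      forall A : algebra_in (lcomod H), separable (forget A)
    & forall A : algebra_in (bicomod H), separable (forget A)].
Proof.
have [lambda lambdaP] := hlambda.
split=> A; apply: averaging_separable.
- exact: rcomod_averaging lambdaP.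
- exact: lcomod_averaging lambdaP.
- exact: bicomod_averaging lambdaP.
Qed.
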